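(* Let $d\ge4$ be an even integer and, for $(a,b)\in\mathbb{R}^2$, let $$\rho_{a,b}^{(d)}=\frac{1-a-b}{d^2}I_d\otimes I_d+a|\omega_d\rangle\langle\omega_d|+\frac bd(I_d\otimes\Omega_d)F_d(I_d\otimes\Omega_d)^*.$$ Let $\mathbb{T}^{(d)}=\{(a,b)\in\mathbb{R}^2:\rho_{a,b}^{(d)}\text{ is a PPT quantum state}\}$ and $\mathbb{S}_k^{(d)}=\{(a,b)\in\mathbb{R}^2:\rho_{a,b}^{(d)}\text{ is a quantum state with }\mathrm{SN}(\rho_{a,b}^{(d)})\le k\}$. Then $\mathbb{T}^{(d)}\setminus\mathbb{S}_k^{(d)}$ is nonempty for all $k=1,\dots,\frac d2-1$, while $\mathbb{T}^{(d)}\subset\mathbb{S}_{d/2}^{(d)}$. Consequently, $$\mathbb{T}^{(d)}\setminus\mathbb{S}_{d/2-1}^{(d)}=\Big\{(a,b)\in\mathbb{R}^2:\ \tfrac1{d-3}a+b>\tfrac1{d+1},\ \ a+(1+d)b\le1,\ \ (1+d)a+b\le1\Big\}$$ is exactly the set of $(a,b)$ for which $\rho_{a,b}^{(d)}$ is a PPT state with Schmidt number precisely $d/2$. Furthermore, every PPT $S\otimes\overline S$-invariant state on $\mathbb{C}^d\otimes\mathbb{C}^d$ has Schmidt number at most $d/2$.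
   Context: $\Omega_d=\begin{pmatrix}0&I_{d/2}\\-I_{d/2}&0\end{pmatrix}$, $|\omega_d\rangle=\frac1{\sqrt d}\sum_{j=1}^d|jj\rangle$, $F_d=\sum_{i,j=1}^d|ij\rangle\langle ji|$, $Sp(d)=\{S\in U(d):S^\top\Omega_dS=\Omega_d\}$. A matrix $X\in M_d(\mathbb{C})\otimes M_d(\mathbb{C})$ is $S\otimes\overline S$-invariant if $(S\otimes\overline S)X(S\otimes\overline S)^*=X$ for all $S\in Sp(d)$ ($\overline S$ = entrywise complex conjugate). A quantum state is a positive semidefinite matrix of trace one; it is PPT if its partial transpose $(\mathrm{id}\otimes\top)(\rho)$ is positive semidefinite. The Schmidt number $\mathrm{SN}(\rho)$ is the smallest $k$ such that $\rho$ is a convex combination of pure states $|\xi\rangle\langle\xi|$ with $\xi$ of Schmidt rank at most $k$. *)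

(* Defs.v *)
From mathcomp Require Import all_boot all_order all_algebra.
From mathcomp Require Import mxtens complex.
From mathcomp Require Import classical_sets reals.

Set Implicit Arguments.
Unset Strict Implicit.
Unset Printing Implicit Defensive.

Import Order.TTheory GRing.Theory Num.Theory.
Local Open Scope ring_scope.
Local Open Scope sesquilinear_scope.
Local Open Scope complex_scope.
Local Open Scope classical_set_scope.

(* C^d (x) C^d is 'cV[C]_(d * d), and M_d(C) (x) M_d(C) is 'M[C]_(d * d); the
   basis vector |ij> has index mxtens_index (i, j), and tensmx is the Kronecker
   product. *)
Notation "A *t B" := (tensmx A B)
  (at level 40, left associativity, format "A  *t  B") : ring_scope.

(* For even d this is the block matrix (0 I; -I 0), written entrywise so that its
   size is d rather than d./2 + d./2. *)
Definition Omega (C : numClosedFieldType) (d : nat) : 'M[C]_d :=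
  \matrix_(i, j) ((j == i + d./2 :> nat)%N%:R - (i == j + d./2 :> nat)%N%:R).

Definition ket (C : numClosedFieldType) (d : nat) (i : 'I_d) : 'cV[C]_d :=
  delta_mx i 0.

Definition ket2 (C : numClosedFieldType) (d : nat) (i j : 'I_d) :
    'cV[C]_(d * d) :=
  ket C i *t ket C j.

Definition omega (C : numClosedFieldType) (d : nat) : 'cV[C]_(d * d) :=
  (sqrtC d%:R)^-1 *: \sum_(j < d) ket2 C j j.

Definition flip (C : numClosedFieldType) (d : nat) : 'M[C]_(d * d) :=
  \sum_(i < d) \sum_(j < d) ket2 C i j *m (ket2 C j i)^t*.

Definition symplectic (C : numClosedFieldType) (d : nat) (S : 'M[C]_d) : Prop :=
  S \is unitarymx /\ S^T *m Omega C d *m S = Omega C d.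

Definition SSbar_invariant (C : numClosedFieldType) (d : nat)
    (X : 'M[C]_(d * d)) : Prop :=
  forall S : 'M[C]_d, symplectic S ->
    (S *t map_mx Num.conj S) *m X *m (S *t map_mx Num.conj S)^t* = X.

Definition psd (C : numClosedFieldType) (n : nat) (A : 'M[C]_n) : Prop :=
  A^t* = A /\ forall v : 'cV[C]_n, 0 <= (v^t* *m A *m v) 0 0.

Definition is_state (C : numClosedFieldType) (n : nat) (rho : 'M[C]_n) : Prop :=
  psd rho /\ \tr rho = 1.

(* id (x) T : the entry <ij| _ |kl> is <il| rho |kj>. *)
Definition partial_transpose (C : numClosedFieldType) (d : nat)
    (rho : 'M[C]_(d * d)) : 'M[C]_(d * d) :=
  \matrix_(u, v)
    rho (mxtens_index ((mxtens_unindex u).1, (mxtens_unindex v).2))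
        (mxtens_index ((mxtens_unindex v).1, (mxtens_unindex u).2)).

Definition is_PPT_state (C : numClosedFieldType) (d : nat)
    (rho : 'M[C]_(d * d)) : Prop :=
  is_state rho /\ psd (partial_transpose rho).

Definition orthonormal_family (C : numClosedFieldType) (d r : nat)
    (e : 'I_r -> 'cV[C]_d) : Prop :=
  forall s t : 'I_r, ((e s)^t* *m e t) 0 0 = (s == t)%:R.

(* xi has a Schmidt decomposition with exactly r nonzero coefficients; r does
   not depend on the decomposition. *)
Definition is_schmidt_rank (C : numClosedFieldType) (d : nat)
    (xi : 'cV[C]_(d * d)) (r : nat) : Prop :=
  exists (lambda : 'I_r -> C) (e f : 'I_r -> 'cV[C]_d),
    [/\ forall t, 0 < lambda t, orthonormal_family e, orthonormal_family f
      & xi = \sum_(t < r) lambda t *: (e t *t f t)].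

(* rho is a convex combination of pure states of Schmidt rank at most k. *)
Definition schmidt_mixture (C : numClosedFieldType) (d : nat)
    (rho : 'M[C]_(d * d)) (k : nat) : Prop :=
  exists (n : nat) (p : 'I_n -> C) (xi : 'I_n -> 'cV[C]_(d * d)),
    [/\ forall t, 0 <= p t, \sum_(t < n) p t = 1,
        forall t, ((xi t)^t* *m xi t) 0 0 = 1,
        forall t, exists2 r : nat, (r <= k)%N & is_schmidt_rank (xi t) r
      & rho = \sum_(t < n) p t *: (xi t *m (xi t)^t*)].

Definition is_schmidt_number (C : numClosedFieldType) (d : nat)
    (rho : 'M[C]_(d * d)) (k : nat) : Prop :=
  schmidt_mixture rho k /\
  forall j : nat, schmidt_mixture rho j -> (k <= j)%N.

Definition schmidt_number_le (C : numClosedFieldType) (d : nat)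
    (rho : 'M[C]_(d * d)) (k : nat) : Prop :=
  exists2 m : nat, (m <= k)%N & is_schmidt_number rho m.

Definition rho_ab (R : realType) (d : nat) (a b : R) : 'M[R[i]]_(d * d) :=
  ((1 - a - b) / d%:R ^+ 2)%:C *: (1%:M *t 1%:M)
  + a%:C *: (omega R[i] d *m (omega R[i] d)^t*)
  + (b / d%:R)%:C *: ((1%:M *t Omega R[i] d) *m flip R[i] d
                        *m (1%:M *t Omega R[i] d)^t*).

Definition PPT_region (R : realType) (d : nat) : set (R * R) :=
  [set ab | is_PPT_state (rho_ab d ab.1 ab.2)].

Definition SN_region (R : realType) (d k : nat) : set (R * R) :=
  [set ab | is_state (rho_ab d ab.1 ab.2) /\
            schmidt_number_le (rho_ab d ab.1 ab.2) k].

Arguments PPT_region R d : clear implicits.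
Arguments SN_region R d k : clear implicits.

(* Main.v *)
(* Write p = sum_{ik} <ii|X|kk> (that is d <omega|X|omega>) and w = tr (W X), where W is
   (1 (x) Omega) F (1 (x) Omega)^*.  A state in the span of 1, |omega><omega| and W is determined
   by (p, w), and partial transposition of rho_{a,b} amounts to exchanging a and b, hence p and w.

   Twirling without Haar measure: averaging over the maximal torus (fifth roots of unity suffice)
   and over the Weyl group leaves, besides the three invariants, three "defects".  Conjugation by
   the symplectic matrix T = (F F; -Fbar Fbar) / sqrt 2, with F the Fourier matrix of size d/2,
   followed by the same average, multiplies each of the defects by -1/d.  If Y and Y' are the
   averages before and after T, (Y + d Y') / (d + 1) is therefore invariant, so the convex hull of
   every Sp(d)-orbit contains an element of the span, and an invariant matrix lies in the span.

   Twirling |0 1>, |0 0*> and k^(-1/2) sum_{t < k} |t t> gives the points (0, 0), (0, 1) and (k, 0),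
   so the whole triangle p, w >= 0, p <= k (1 - w) has Schmidt number at most k.  Conversely, for a
   unit vector with coefficient matrix M of rank at most k and Z = Y - Y^T with Y = M Omega,
   |tr M|^2 <= k |Z|^2 / 2 = k (1 - w), so p <= k (1 - w) is necessary.  A PPT state satisfies
   p, w >= 0 and p <= (d/2) (1 - w), and the line of the statement is p = (d/2 - 1) (1 - w). *)

Require Import Defs.
From mathcomp Require Import boolp classical_sets reals.
From mathcomp Require Import all_boot all_order all_algebra all_fingroup.
From mathcomp Require Import cyclic separable cyclotomic mxtens complex ring lra zify.

Set Implicit Arguments.
Unset Strict Implicit.
Unset Printing Implicit Defensive.

Import Order.TTheory GRing.Theory Num.Theory.
Local Open Scope ring_scope.
Local Open Scope sesquilinear_scope.

(** * Matrix entries and the symplectic form *)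

(* <ij| X |kl> *)
Definition ent (K : Type) (d : nat) (X : 'M[K]_(d * d)) (i j k l : 'I_d) : K :=
  X (mxtens_index (i, j)) (mxtens_index (k, l)).

Lemma ent_inj (K : Type) (d : nat) (X Y : 'M[K]_(d * d)) :
  (forall i j k l, ent X i j k l = ent Y i j k l) -> X = Y.
Proof.
move=> h; apply/matrixP => u v.
by case: (mxtens_indexP u) => i j; case: (mxtens_indexP v) => k l; exact: h.
Qed.

Lemma sum_mxtens (R : nmodType) (d : nat) (F : 'I_(d * d) -> R) :
  \sum_u F u = \sum_i \sum_j F (mxtens_index (i, j)).
Proof.
rewrite pair_big (reindex (@mxtens_index d d)) /=; last first.
  by exists (@mxtens_unindex d d) => u _; rewrite (mxtens_indexK, mxtens_unindexK).
by apply: eq_bigr => -[i j].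
Qed.

Lemma sum_delta (R : pzSemiRingType) (I : finType) (a : I) (F : I -> R) :
  \sum_i (i == a)%:R * F i = F a.
Proof.
rewrite (bigD1 a) //= eqxx mul1r big1 ?addr0 // => i /negPf->.
by rewrite mul0r.
Qed.

Lemma adjmxM (C : numClosedFieldType) m n p (A : 'M[C]_(m, n)) (B : 'M[C]_(n, p)) :
  (A *m B)^t* = B^t* *m A^t*.
Proof. by rewrite trmx_mul map_mxM. Qed.

Lemma adjmxK (C : numClosedFieldType) m n (A : 'M[C]_(m, n)) : A^t*^t* = A.
Proof. by apply/matrixP=> i j; rewrite !mxE conjCK. Qed.

Lemma adjmx_tens (C : numClosedFieldType) m n p q (A : 'M[C]_(m, n)) (B : 'M[C]_(p, q)) :
  (A *t B)^t* = A^t* *t B^t*.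
Proof. by apply/matrixP=> i j; rewrite !mxE rmorphM. Qed.

Lemma map_conjM (C : numClosedFieldType) m n p (A : 'M[C]_(m, n)) (B : 'M[C]_(n, p)) :
  map_mx Num.conj (A *m B) = map_mx Num.conj A *m map_mx Num.conj B.
Proof. exact: map_mxM. Qed.

Lemma tensmx1 (R : pzRingType) m n : (1%:M : 'M[R]_m) *t (1%:M : 'M[R]_n) = 1%:M.
Proof.
apply/matrixP => u v; case: (mxtens_indexP u) => i j; case: (mxtens_indexP v) => k l.
rewrite tensmxE !mxE (can_eq (@mxtens_indexK m n)) xpair_eqE.
by case: (i == k); case: (j == l); rewrite ?mul1r ?mul0r.
Qed.

(* The index paired with i by Omega (for even d). *)
Definition star (d : nat) (i : 'I_d) : 'I_d :=
  Ordinal (ltn_pmod (i + d./2) (leq_ltn_trans (leq0n i) (ltn_ord i))).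

(** For even [d], the only nonzero entry of [Omega] in row [i]; it sits in column [star i]. *)
Definition sgn (R : pzRingType) (d : nat) (i : 'I_d) : R :=
  if (i < d./2)%N then 1 else -1.

Lemma sgn2 (R : pzRingType) d (i : 'I_d) : sgn R i * sgn R i = 1.
Proof. by rewrite /sgn; case: ifP; rewrite ?mul1r ?mulrNN ?mulr1. Qed.

Section Star.
Context (d : nat) (d_even : ~~ odd d).

Lemma even_halfE : (d = d./2 + d./2)%N.
Proof. by rewrite addnn -[LHS](odd_double_half d) (negPf d_even). Qed.

Lemma star_val (i : 'I_d) :
  star i = (if (i < d./2)%N then i + d./2 else i - d./2)%N :> nat.
Proof.
have hd := even_halfE; have hi := ltn_ord i; rewrite /=; case: ltnP => h.
  by rewrite modn_small //; lia.
have -> : (i + d./2 = (i - d./2) + d)%N by lia.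
by rewrite modnDr modn_small //; lia.
Qed.

Lemma starK : involutive (@star d).
Proof.
move=> i; apply: ord_inj; have hd := even_halfE; have hi := ltn_ord i.
by rewrite !star_val; case: (ltnP i d./2) => h; case: ifP; lia.
Qed.

Lemma star_neq (i : 'I_d) : (star i == i) = false.
Proof.
apply/negP => /eqP /(congr1 (@nat_of_ord d)); rewrite star_val.
by have hi := ltn_ord i; have hd := even_halfE; case: ifP; lia.
Qed.

Lemma neq_star (i : 'I_d) : (i == star i) = false.
Proof. by rewrite eq_sym star_neq. Qed.

Lemma star_inj : injective (@star d).
Proof. exact: (can_inj starK). Qed.

Lemma star_eq (i j : 'I_d) : (star i == star j) = (i == j).
Proof. exact: (inj_eq star_inj). Qed.

Lemma star_eqC (i j : 'I_d) : (star i == j) = (i == star j).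
Proof. by rewrite -{1}(starK j) star_eq. Qed.

Lemma star_lt (i : 'I_d) : (star i < d./2)%N = ~~ (i < d./2)%N.
Proof.
rewrite star_val; have hd := even_halfE; have hi := ltn_ord i.
by case: (ltnP i d./2) => h; lia.
Qed.

Lemma sgn_star (R : pzRingType) (i : 'I_d) : sgn R (star i) = - sgn R i.
Proof.
by rewrite /sgn star_lt; case: (i < d./2)%N; rewrite /= ?opprK.
Qed.

Lemma OmegaE (C : numClosedFieldType) (i j : 'I_d) :
  Omega C d i j = sgn C i * (j == star i)%:R.
Proof.
rewrite mxE -[j == star i]/(nat_of_ord j == nat_of_ord (star i)) star_val /sgn.
have hd := even_halfE; have hi := ltn_ord i; have hj := ltn_ord j.
case: ifP => h.
  have -> : (i == (j + d./2)%N :> nat) = false by apply/negP => /eqP; lia.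
  by rewrite subr0 mul1r.
have -> : (j == (i + d./2)%N :> nat) = false by apply/negP => /eqP; lia.
by rewrite sub0r mulN1r; congr (- (nat_of_bool _)%:R); lia.
Qed.

Lemma Omega_tr (C : numClosedFieldType) : (Omega C d)^T = - Omega C d.
Proof.
apply/matrixP => i j; rewrite mxE [RHS]mxE.
rewrite !OmegaE eq_sym star_eqC; case: eqP => [->|_]; last by rewrite !mulr0 oppr0.
by rewrite sgn_star !mulr1.
Qed.

Lemma conj_sgn (C : numClosedFieldType) (i : 'I_d) : (sgn C i)^* = sgn C i.
Proof. by rewrite /sgn; case: ifP; rewrite ?rmorphN rmorph1. Qed.

Lemma Omega_conj (C : numClosedFieldType) : map_mx Num.conj (Omega C d) = Omega C d.
Proof.
by apply/matrixP => i j; rewrite mxE OmegaE rmorphM /= conj_sgn conjC_nat.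
Qed.

Lemma Omega_adj (C : numClosedFieldType) : (Omega C d)^t* = - Omega C d.
Proof. by rewrite Omega_tr map_mxN Omega_conj. Qed.

Lemma mul_OmegaE (C : numClosedFieldType) n (A : 'M[C]_(d, n)) i j :
  (Omega C d *m A) i j = sgn C i * A (star i) j.
Proof.
rewrite mxE (eq_bigr (fun k => (k == star i)%:R * (sgn C i * A k j))) ?sum_delta //.
by move=> k _; rewrite OmegaE mulrCA mulrA.
Qed.

Lemma Omega2 (C : numClosedFieldType) : Omega C d *m Omega C d = - 1%:M.
Proof.
apply/matrixP => i j; rewrite mul_OmegaE OmegaE starK sgn_star !mxE.
by rewrite mulrA mulrN sgn2 mulN1r eq_sym.
Qed.

End Star.

(** * Convex hulls of symplectic orbits *)

Section Twirl.
Context (C : numClosedFieldType) (d : nat).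
Implicit Types (S : 'M[C]_d) (X Y Z : 'M[C]_(d * d)).

Definition vent (v : 'cV[C]_(d * d)) (i j : 'I_d) : C := v (mxtens_index (i, j)) 0.

Lemma vent_tens (u v : 'cV[C]_d) i j : vent (u *t v) i j = u i 0 * v j 0.
Proof. by rewrite /vent mxE mxtens_indexK; congr (u _ _ * v _ _); apply: ord_inj. Qed.

Lemma vent_ket2 (i j k l : 'I_d) : vent (ket2 C k l) i j = (i == k)%:R * (j == l)%:R.
Proof. by rewrite vent_tens !mxE !andbT. Qed.

Lemma ent_proj (u v : 'cV[C]_(d * d)) i j k l :
  ent (u *m v^t*) i j k l = vent u i j * (vent v k l)^*.
Proof. by rewrite /ent mxE big_ord1 !mxE. Qed.

(** A single conjugation, not an average; averages are convex combinations of such terms. *)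
Definition tw S X : 'M[C]_(d * d) :=
  (S *t map_mx Num.conj S) *m X *m (S *t map_mx Num.conj S)^t*.

Lemma ent_mull (A B : 'M[C]_d) X i j k l :
  ent ((A *t B) *m X) i j k l = \sum_i' \sum_j' A i i' * B j j' * ent X i' j' k l.
Proof.
rewrite /ent mxE sum_mxtens; apply: eq_bigr => i' _; apply: eq_bigr => j' _.
by rewrite tensmxE.
Qed.

Lemma ent_mulr (A B : 'M[C]_d) X i j k l :
  ent (X *m (A *t B)^t*) i j k l =
  \sum_k' \sum_l' (A k k')^* * (B l l')^* * ent X i j k' l'.
Proof.
rewrite /ent mxE sum_mxtens; apply: eq_bigr => k' _; apply: eq_bigr => l' _.
by rewrite mulrC !mxE !mxtens_indexK rmorphM.
Qed.

Lemma ent_tw S X i j k l : ent (tw S X) i j k l =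
  \sum_i' \sum_j' \sum_k' \sum_l'
    S i i' * (S j j')^* * (S k k')^* * S l l' * ent X i' j' k' l'.
Proof.
rewrite /tw -mulmxA ent_mull; apply: eq_bigr => i' _; apply: eq_bigr => j' _.
rewrite ent_mulr mulr_sumr; apply: eq_bigr => k' _.
rewrite mulr_sumr; apply: eq_bigr => l' _.
by rewrite !mxE conjCK !mulrA.
Qed.

Lemma entD X Y i j k l : ent (X + Y) i j k l = ent X i j k l + ent Y i j k l.
Proof. by rewrite /ent mxE. Qed.

Lemma entZ a X i j k l : ent (a *: X) i j k l = a * ent X i j k l.
Proof. by rewrite /ent mxE. Qed.

Lemma ent1 i j k l : ent (1%:M : 'M[C]_(d * d)) i j k l = (i == k)%:R * (j == l)%:R.
Proof. by rewrite -tensmx1 /ent tensmxE !mxE. Qed.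

(** This is sqrt d times [omega]; without the normalisation all entries are 0 or 1. *)
Definition maxent : 'cV[C]_(d * d) := \sum_(j < d) ket2 C j j.

Lemma ventZ a v i j : vent (a *: v) i j = a * vent v i j.
Proof. by rewrite /vent mxE. Qed.

Lemma vent_sum (I : Type) (r : seq I) (P : pred I) (F : I -> 'cV[C]_(d * d)) i j :
  vent (\sum_(t <- r | P t) F t) i j = \sum_(t <- r | P t) vent (F t) i j.
Proof. by rewrite /vent summxE. Qed.

Lemma vent_maxent i j : vent maxent i j = (i == j)%:R.
Proof.
rewrite vent_sum (eq_bigr (fun k => (k == i)%:R * (j == k)%:R)) ?sum_delta.
  by rewrite eq_sym.
by move=> k _; rewrite vent_ket2 eq_sym.
Qed.

Lemma ent_flip i j k l : ent (flip C d) i j k l = (l == i)%:R * (k == j)%:R.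
Proof.
rewrite /ent /flip summxE.
rewrite (eq_bigr (fun a => (a == i)%:R * ((l == a)%:R * (k == j)%:R))) ?sum_delta //.
move=> a _; rewrite summxE.
rewrite (eq_bigr (fun b => (b == j)%:R * ((a == i)%:R * (l == a)%:R * (k == b)%:R))).
  by rewrite sum_delta mulrA.
move=> b _; rewrite -/(ent _ _ _ _ _) ent_proj !vent_ket2 rmorphM /= !conjC_nat.
by rewrite [i == a]eq_sym [j == b]eq_sym; ring.
Qed.

Definition symflip : 'M[C]_(d * d) :=
  (1%:M *t Omega C d) *m flip C d *m (1%:M *t Omega C d)^t*.

(** The general element of the span of the three invariants 1, d |omega><omega| and W =
    [symflip]. *)
Definition inv3 a b c : 'M[C]_(d * d) :=
  a *: 1%:M + b *: (maxent *m maxent^t*) + c *: symflip.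

Lemma tw_add S X Y : tw S (X + Y) = tw S X + tw S Y.
Proof. by rewrite /tw mulmxDr mulmxDl. Qed.

Lemma tw_scale S a X : tw S (a *: X) = a *: tw S X.
Proof. by rewrite /tw -scalemxAr -scalemxAl. Qed.

Lemma flip_tens (A B : 'M[C]_d) : flip C d *m (A *t B) = (B *t A) *m flip C d.
Proof.
apply: ent_inj => i j k l.
rewrite ent_mull /ent mxE sum_mxtens.
transitivity (A j k * B i l).
  rewrite -[RHS](sum_delta j (fun a => A a k * B i l)); apply: eq_bigr => a _.
  rewrite -[in RHS](sum_delta i (fun b => A a k * B b l)) mulr_sumr.
  by apply: eq_bigr => b _; rewrite -/(ent _ _ _ _ _) ent_flip tensmxE; ring.
rewrite -[LHS](sum_delta l (fun a => A j k * B i a)); apply: eq_bigr => a _.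
rewrite -[in LHS](sum_delta k (fun b => A j b * B i a)) mulr_sumr.
apply: eq_bigr => b _; rewrite -/(ent _ _ _ _ _) ent_flip (eq_sym l) (eq_sym k).
by ring.
Qed.

Lemma symplectic_unit S : symplectic S -> S *m S^t* = 1%:M.
Proof. by case=> /unitarymxP. Qed.

Lemma symplectic_unitV S : symplectic S -> S^t* *m S = 1%:M.
Proof. by move=> /symplectic_unit; apply: mulmx1C. Qed.

Lemma map_conjK m n (A : 'M[C]_(m, n)) : map_mx Num.conj (map_mx Num.conj A) = A.
Proof. by apply/matrixP => i j; rewrite !mxE conjCK. Qed.

Lemma symplectic_conj_unitV S : symplectic S -> S^T *m map_mx Num.conj S = 1%:M.
Proof.
by move=> /symplectic_unitV/(congr1 (map_mx Num.conj)); rewrite map_conjM map_conjK map_mx1.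
Qed.

Lemma symplectic_conj_unit S : symplectic S -> map_mx Num.conj S *m S^T = 1%:M.
Proof. by move=> /symplectic_conj_unitV; apply: mulmx1C. Qed.

(** [conj S] is a left inverse of [S^T], so it cancels the first factor of S^T Omega S = Omega. Thus
    Omega intertwines S with its conjugate. *)
Lemma symplectic_intertwine S : symplectic S ->
  map_mx Num.conj S *m Omega C d = Omega C d *m S.
Proof.
move=> hS; have [_ {1}<-] := hS.
by rewrite !mulmxA symplectic_conj_unit // mul1mx.
Qed.

Lemma tens_conj_unit S : symplectic S ->
  (S *t map_mx Num.conj S) *m (S *t map_mx Num.conj S)^t* = 1%:M.
Proof.
move=> hS; rewrite adjmx_tens tensmx_mul symplectic_unit //.
by rewrite map_trmx map_conjK symplectic_conj_unit // tensmx1.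
Qed.

(** [maxent] is fixed because S is unitary. For [symflip], the local Omega turns S (x) conj S into S
    (x) S, which commutes with the flip. *)
Lemma tw_inv3 S a b c : symplectic S -> tw S (inv3 a b c) = inv3 a b c.
Proof.
move=> hS; rewrite /inv3 !tw_add !tw_scale.
have -> : tw S 1%:M = 1%:M by rewrite /tw mulmx1 tens_conj_unit.
have hw : (S *t map_mx Num.conj S) *m maxent = maxent.
  apply/matrixP => u q; rewrite ord1; case: (mxtens_indexP u) => i j.
  rewrite -[RHS]/(vent maxent i j) vent_maxent mxE sum_mxtens.
  have /matrixP/(_ i j) := symplectic_unit hS; rewrite !mxE => <-.
  apply: eq_bigr => k _.
  rewrite -(sum_delta k (fun l => S i k * (S^t* l j))).
  by apply: eq_bigr => l _; rewrite tensmxE -/(vent _ _ _) vent_maxent !mxE eq_sym mulrC.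
have -> : tw S (maxent *m maxent^t*) = maxent *m maxent^t*.
  by rewrite /tw mulmxA hw -mulmxA -adjmxM hw.
congr (_ + _ *: _); rewrite /tw /symflip.
have hO : (S *t map_mx Num.conj S) *m (1%:M *t Omega C d)
   = (1%:M *t Omega C d) *m (S *t S).
  by rewrite !tensmx_mul mulmx1 mul1mx symplectic_intertwine.
rewrite !mulmxA hO -mulmxA -adjmxM hO adjmxM !mulmxA; congr (_ *m _).
rewrite -!mulmxA; congr (_ *m _); rewrite mulmxA -flip_tens -mulmxA.
by rewrite adjmx_tens tensmx_mul symplectic_unit // tensmx1 mulmx1.
Qed.

(* Y lies in the convex hull of the Sp(d)-orbit of X. *)
Inductive reach X : 'M[C]_(d * d) -> Prop :=
| reach_refl : reach X X
| reach_tw S Y : symplectic S -> reach X Y -> reach X (tw S Y)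
| reach_conv a Y Z : 0 <= a -> a <= 1 -> reach X Y -> reach X Z ->
    reach X (a *: Y + (1 - a) *: Z).

Lemma reach_trans Y X Z : reach X Y -> reach Y Z -> reach X Z.
Proof.
move=> hXY; elim=> {Z} [|S Z hS _ hZ|a Z Z' a0 a1 _ hZ _ hZ'] //.
  exact: reach_tw.
exact: reach_conv.
Qed.

(** Uniform means arise from two-point combinations: the n+1st term enters with weight 1/(n+1), the
    mean of the other n with the rest. *)
Lemma reach_mean (I : Type) (r : seq I) (F : I -> 'M[C]_(d * d)) X :
  (0 < size r)%N -> (forall i, reach X (F i)) ->
  reach X ((size r)%:R^-1 *: \sum_(i <- r) F i).
Proof.
move=> + hF; elim: r => [|x [|y r] ih] // _.
  by rewrite big_seq1 invr1 scale1r.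
have {}ih := ih isT; rewrite big_cons.
set n := size (y :: r) in ih *; set G := \sum_(i <- y :: r) F i in ih *.
have n0 : n%:R != 0 :> C by rewrite pnatr_eq0.
have n1 : n.+1%:R != 0 :> C by rewrite pnatr_eq0.
suff -> : (size [:: x, y & r])%:R^-1 *: (F x + G) =
   n.+1%:R^-1 *: F x + (1 - n.+1%:R^-1) *: (n%:R^-1 *: G).
  by apply: reach_conv => //; rewrite ?invr_ge0 ?ler0n // invf_le1 ?ltr0n // ler1n.
rewrite scalerDr scalerA; congr (_ + _ *: _).
by rewrite -/n.+1 -[n.+1%:R]natr1 in n1 *; field; rewrite n0 n1.
Qed.

(** The orbit of an invariant matrix is a single point, and so is its convex hull. This turns
    statements on hulls into statements on invariant matrices. *)
Lemma reach_invariant X Y : SSbar_invariant X -> reach X Y -> Y = X.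
Proof.
move=> hX; elim=> {Y} [|S Y hS _ ->|a Y Z _ _ _ -> _ ->] //.
  exact: hX.
by rewrite -scalerDl addrC subrK scale1r.
Qed.

Lemma tr_tw S X A : symplectic S -> (forall T, symplectic T -> tw T A = A) ->
  \tr (A *m tw S X) = \tr (A *m X).
Proof.
move=> hS hA; rewrite -{1}(hA _ hS) /tw.
set U := S *t map_mx Num.conj S.
have hU : U^t* *m U = 1%:M by apply/mulmx1C/tens_conj_unit.
have -> : U *m A *m U^t* *m (U *m X *m U^t*) = U *m (A *m X) *m U^t*.
  by rewrite -!mulmxA (mulmxA (U^t*) U) hU mul1mx.
by rewrite mxtrace_mulC mulmxA hU mul1mx.
Qed.

(** Pairing with an invariant matrix is constant on the orbit and linear, hence constant on the
    hull. Trace, p and w are such pairings. *)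
Lemma reach_tr X Y A : (forall T, symplectic T -> tw T A = A) -> reach X Y ->
  \tr (A *m Y) = \tr (A *m X).
Proof.
move=> hA; elim=> {Y} [|S Y hS _ <-|a Y Z _ _ _ hY _ hZ] //.
  exact: tr_tw.
rewrite mulmxDr -!scalemxAr mxtraceD !mxtraceZ hY hZ -mulrDl addrC subrK.
by rewrite mul1r.
Qed.

End Twirl.

(** * Torus and Weyl averages *)

Section Torus.
Context (C : numClosedFieldType) (d : nat) (d_even : ~~ odd d).
Implicit Types (S : 'M[C]_d) (X Y Z : 'M[C]_(d * d)).

Lemma ent_local_Omega X i j k l :
  ent ((1%:M *t Omega C d) *m X *m (1%:M *t Omega C d)^t*) i j k l =
  sgn C j * sgn C l * ent X i (star j) k (star l).
Proof.
have delta (a b : 'I_d) (F : 'I_d -> 'I_d -> C) :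
    \sum_a' \sum_b' (1%:M : 'M[C]_d) a a' * Omega C d b b' * F a' b' = sgn C b * F a (star b).
  rewrite -(sum_delta a (fun a' => sgn C b * F a' (star b))); apply: eq_bigr => a' _.
  rewrite -(sum_delta (star b) (fun b' => sgn C b * F a' b')) mulr_sumr.
  by apply: eq_bigr => b' _; rewrite mxE OmegaE // (eq_sym a); ring.
rewrite -mulmxA ent_mull delta ent_mulr -mulrA; congr (_ * _).
rewrite -delta; apply: eq_bigr => k' _; apply: eq_bigr => l' _.
by rewrite mxE OmegaE // rmorphM /= !conjC_nat conj_sgn.
Qed.

Lemma ent_symflip (i j k l : 'I_d) :
  ent (symflip C d) i j k l =
  - (sgn C i * sgn C j * ((k == star j)%:R * (l == star i)%:R)).
Proof.
rewrite ent_local_Omega ent_flip star_eqC //; case: eqP => [->|_].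
  by rewrite sgn_star //; ring.
by rewrite !(mulr0, mul0r) oppr0.
Qed.

Lemma ent_inv3 a b c (i j k l : 'I_d) :
  ent (inv3 d a b c : 'M[C]_(d * d)) i j k l =
  a * ((i == k)%:R * (j == l)%:R) + b * ((i == j)%:R * (k == l)%:R)
  - c * (sgn C i * sgn C j * ((k == star j)%:R * (l == star i)%:R)).
Proof.
rewrite !entD !entZ ent1 ent_proj !vent_maxent conjC_nat ent_symflip.
by rewrite mulrN.
Qed.

(** The entrywise hypothesis is Omega S = conj S Omega; multiplying by [S^T] and using unitarity
    gives the symplectic identity. *)
Lemma symplectic_of_star S : S *m S^t* = 1%:M ->
  (forall i r, S (star i) (star r) = sgn C i * sgn C r * (S i r)^*) -> symplectic S.
Proof.
move=> hU hs; split; first exact/unitarymxP.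
have hO : Omega C d *m S = map_mx Num.conj S *m Omega C d.
  apply/matrixP => i j; rewrite mul_OmegaE // mxE.
  rewrite (eq_bigr (fun k => (k == star j)%:R * (sgn C k * (S i k)^*))).
    rewrite sum_delta sgn_star // -{1}(starK d_even j) hs sgn_star // mulrA.
    by rewrite mulrA sgn2 mul1r.
  move=> k _; rewrite OmegaE // mxE eq_sym -star_eqC // eq_sym; ring.
rewrite -mulmxA hO mulmxA.
have := mulmx1C hU; move=> /(congr1 (map_mx Num.conj)); rewrite map_conjM map_conjK map_mx1.
by move->; rewrite mul1mx.
Qed.

(** Monomial matrices cover both averages: diagonal torus elements for [w = 1], and signed
    permutations for the Weyl group. *)
Definition monomx (c : 'I_d -> C) (w : {perm 'I_d}) : 'M[C]_d :=
  \matrix_(i, j) (c i * (j == w i)%:R).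

Lemma monomx_symplectic (c : 'I_d -> C) (w : {perm 'I_d}) :
  (forall i, c i * (c i)^* = 1) -> (forall i, w (star i) = star (w i)) ->
  (forall i, c (star i) = sgn C i * sgn C (w i) * (c i)^*) ->
  symplectic (monomx c w).
Proof.
move=> hc hw hs; apply: symplectic_of_star.
  apply/matrixP => i j; rewrite !mxE.
  rewrite (eq_bigr (fun k => (k == w i)%:R * (c i * (c j)^* * (k == w j)%:R))).
    rewrite sum_delta (inj_eq perm_inj); case: eqP => [->|_]; last by rewrite mulr0.
    by rewrite hc mulr1.
  by move=> k _; rewrite !mxE rmorphM /= conjC_nat; ring.
move=> i r; rewrite !mxE hw star_eq // hs rmorphM /= conjC_nat.
by case: eqP => [->|_]; rewrite ?mulr0 // !mulr1.
Qed.

Lemma ent_tw_monomx (c : 'I_d -> C) (w : {perm 'I_d}) X i j k l :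
  ent (tw (monomx c w) X) i j k l =
  c i * (c j)^* * (c k)^* * c l * ent X (w i) (w j) (w k) (w l).
Proof.
rewrite ent_tw.
rewrite -(sum_delta (w i) (fun i' => c i * (c j)^* * (c k)^* * c l * ent X i' (w j) (w k) (w l))).
apply: eq_bigr => i' _.
rewrite -(sum_delta (w j) (fun j' => c i * (c j)^* * (c k)^* * c l * ent X i' j' (w k) (w l))).
rewrite mulr_sumr; apply: eq_bigr => j' _.
rewrite -(sum_delta (w k) (fun k' => c i * (c j)^* * (c k)^* * c l * ent X i' j' k' (w l))).
rewrite !mulr_sumr; apply: eq_bigr => k' _.
rewrite -(sum_delta (w l) (fun l' => c i * (c j)^* * (c k)^* * c l * ent X i' j' k' l')).
rewrite !mulr_sumr; apply: eq_bigr => l' _.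
by rewrite !mxE !rmorphM /= !conjC_nat; ring.
Qed.

(* Net charge of |ij><kl| under the torus generator at x is pcnt x - pcnt (star x). *)
Definition pcnt (x i j k l : 'I_d) : nat :=
  ((i == x) + (l == x) + (j == star x) + (k == star x))%N.

(** In this order, the supports of the projector on [maxent], of the identity and of [symflip]. *)
Definition balanced (i j k l : 'I_d) : bool :=
  [|| (i == j) && (k == l), (i == k) && (j == l) | (k == star j) && (l == star i)].

(** The operators of torus weight zero are exactly those on the supports of the three invariants.
    For the converse it is enough to read the charge at [l], or at [i] and then at [star j]. *)
Lemma balancedP i j k l :
  balanced i j k l = [forall x, pcnt x i j k l == pcnt (star x) i j k l].
Proof.
apply/idP/forallP => [|h].
  case/or3P => /andP[/eqP-> /eqP->] x; rewrite /pcnt starK //.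
  - by apply/eqP; lia.
  - by apply/eqP; lia.
  by rewrite !star_eq // !star_eqC //; apply/eqP; lia.
have {}h x : (((i == x) + (l == x) + (j == star x) + (k == star x)) =
   ((i == star x) + (l == star x) + (j == x) + (k == x)))%N.
  by move/eqP: (h x); rewrite /pcnt starK.
rewrite /balanced; case: (eqVneq i j) h => [<-{j}|nij] h /=.
  case: (eqVneq k l) h => //= nkl h; have := h l.
  by rewrite eqxx neq_star // (negPf nkl); lia.
case: (eqVneq i k) h => [<-{k}|nik] h /=.
  case: (eqVneq j l) h => //= njl h; have := h l.
  by rewrite eqxx neq_star // (negPf njl); lia.
have := h i; rewrite eqxx neq_star // (eq_sym j i) (negPf nij) (eq_sym k i) (negPf nik).
case: (eqVneq l (star i)) h => [->|]; last by lia.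
move=> h _; have := h (star j); rewrite !starK // eqxx star_eq //.
by rewrite (eq_sym j) star_neq //= star_eqC //; case: (k == star j) => //; lia.
Qed.

End Torus.

(** X^n - 1 splits over a closed field and is separable in characteristic 0, so it has n distinct
    roots, among which one is primitive. *)
Lemma prim_root_exists (C : numClosedFieldType) n :
  (0 < n)%N -> exists z : C, n.-primitive_root z.
Proof.
pose p : {poly C} := 'X^n - 1; have [r Dp] := closed_field_poly_normal p.
move=> n_gt0; rewrite (monicP _) ?monicXnsubC // scale1r in Dp.
have rn1: all n.-unity_root r by apply/allP=> z; rewrite -root_prod_XsubC -Dp.
have sz_r: (n < (size r).+1)%N by rewrite -(size_prod_XsubC r id) -Dp size_XnsubC.
have [|z] := hasP (has_prim_root n_gt0 rn1 _ sz_r); last by exists z.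
by rewrite -separable_prod_XsubC -Dp separable_Xn_sub_1 // pnatr_eq0 -lt0n.
Qed.

Lemma unity_conj (C : numClosedFieldType) n (z : C) : (0 < n)%N -> z ^+ n = 1 -> z * z^* = 1.
Proof.
move=> n0 h; have /eqP : `|z| ^+ n = 1 by rewrite -normrX h normr1.
rewrite pexpr_eq1 // => /eqP h1; by rewrite -normCK h1 expr1n.
Qed.

Lemma sum_unity_root (K : fieldType) n (u : K) : u ^+ n = 1 -> u != 1 ->
  \sum_(a < n) u ^+ a = 0.
Proof.
move=> un u1; have /eqP := subrX1 u n; rewrite un subrr eq_sym mulf_eq0 subr_eq0.
by rewrite (negPf u1) => /eqP.
Qed.

Section Weyl.
Context (C : numClosedFieldType) (d : nat) (d_even : ~~ odd d).
Implicit Types (S : 'M[C]_d) (X Y Z : 'M[C]_(d * d)).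

(* The charges lie in [-4, 4], so fifth roots of unity detect the zero charge. *)
Lemma reach_charge x X : exists2 Y, reach X Y &
  forall i j k l, ent Y i j k l =
   if pcnt x i j k l == pcnt (star x) i j k l then ent X i j k l else 0.
Proof.
have [z hz] := @prim_root_exists C 5 isT.
have z5 := prim_expr_order hz.
have zz : z * z^* = 1 by apply: (@unity_conj _ 5).
(* The torus element that rotates coordinate [x] by z^a and its partner by the inverse phase, fixing
   the others. *)
pose c (a : 'I_5) (i : 'I_d) : C :=
  if i == x then z ^+ a else if i == star x then z^* ^+ a else 1.
have cE a i : c a i = z ^+ (a * (i == x)) * z^* ^+ (a * (i == star x)).
  rewrite /c; case: (eqVneq i x) => [->|_].
    by rewrite neq_star // muln0 muln1 mulr1.
  by case: eqP => _; rewrite ?muln0 ?muln1 ?mul1r ?mulr1.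
have hS a : symplectic (monomx (c a) 1).
  apply: monomx_symplectic => // i; rewrite ?perm1 //.
    by rewrite cE rmorphM /= !rmorphXn /= conjCK mulrACA -!exprMn [z^* * z]mulrC zz
      !expr1n mulr1.
  by rewrite sgn2 mul1r !cE !star_eqC // starK // rmorphM /= !rmorphXn /= conjCK mulrC.
pose F (a : 'I_5) := tw (monomx (c a) 1) X.
exists ((size (enum 'I_5))%:R^-1 *: \sum_(a <- enum 'I_5) F a).
  apply: reach_mean; first by rewrite size_enum_ord.
  by move=> a; apply: reach_tw => //; exact: reach_refl.
move=> i j k l; rewrite entZ size_enum_ord /ent summxE big_enum /=.
set p := pcnt x i j k l; set q := pcnt (star x) i j k l.
have hF a : F a (mxtens_index (i, j)) (mxtens_index (k, l)) =
    (z ^+ p * z^* ^+ q) ^+ a * ent X i j k l.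
  rewrite -/(ent _ _ _ _ _) ent_tw_monomx !perm1 !cE; congr (_ * _).
  rewrite !rmorphM /= !rmorphXn /= conjCK /p /q /pcnt starK //.
  by rewrite exprMn -!exprM ![(_ * nat_of_ord a)%N]mulnC !mulnDr !exprD; ring.
under eq_bigr do rewrite hF.
rewrite -mulr_suml -/(ent X i j k l); case: eqP => hpq.
  under eq_bigr do rewrite hpq -exprMn zz !expr1n.
  by rewrite sumr_const card_ord -mulr_natl mulr1 mulrA mulVf ?mul1r // pnatr_eq0.
(* The phase becomes z^(p + 4q), and p + 4q is congruent to p - q modulo 5. *)
have zV : z^* = z ^+ 4.
  by rewrite -[LHS]mul1r -z5 (exprSr z 4) -mulrA zz mulr1.
rewrite sum_unity_root ?mul0r ?mulr0 //.
  rewrite exprMn (exprAC z) z5 expr1n mul1r (exprAC z^*) -[z^* ^+ 5]rmorphXn z5 rmorph1.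
  by rewrite expr1n.
rewrite zV -exprM -exprD -(prim_order_dvd hz).
have : (p <= 4)%N by rewrite /p /pcnt; lia.
have : (q <= 4)%N by rewrite /q /pcnt; lia.
by move=> h1 h2; apply/negP => h3; apply: hpq; lia.
Qed.

(** The one-coordinate filter is applied for each [x] in turn; what survives all of them has zero
    charge everywhere. *)
Lemma reach_balanced X : exists2 Y, reach X Y &
  forall i j k l, ent Y i j k l = if balanced i j k l then ent X i j k l else 0.
Proof.
suff [Y hY hE] : exists2 Y, reach X Y & forall i j k l, ent Y i j k l =
   if all (fun x => pcnt x i j k l == pcnt (star x) i j k l) (enum 'I_d)
   then ent X i j k l else 0.
  exists Y => // i j k l; rewrite hE balancedP //; congr (if _ then _ else _).
  apply/allP/forallP => h x; first by apply: h; rewrite mem_enum.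
  by move=> _; exact: h.
elim: (enum _) => [|x s [Y hY hE]] /=; first by exists X => //; exact: reach_refl.
have [Z hZ hZE] := reach_charge x Y; exists Z; first exact: reach_trans hZ.
by move=> i j k l; rewrite hZE hE; do !case: ifP.
Qed.

(** The Weyl group of type C, realised as the permutations of the d indices that respect the pairing
    by [star]. *)
Definition weyl : {set {perm 'I_d}} :=
  [set w : {perm 'I_d} | [forall i, w (star i) == star (w i)]].

Lemma weylP (w : {perm 'I_d}) :
  reflect (forall i, w (star i) = star (w i)) (w \in weyl).
Proof. by rewrite inE; apply: (iffP forallP) => h i; apply/eqP. Qed.

Lemma weyl1 : 1%g \in weyl.
Proof. by apply/weylP => i; rewrite !perm1. Qed.

Lemma weyl_mul v w : v \in weyl -> (v * w)%g \in weyl = (w \in weyl).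
Proof.
move=> /weylP hv; apply/weylP/weylP => h i; last by rewrite !permM hv h.
have := h (v^-1%g i); rewrite !permM hv permKV //.
Qed.

(* Sign making the monomial matrix of w symplectic. *)
Definition weyl_sign (w : {perm 'I_d}) (i : 'I_d) : C :=
  if (i < d./2)%N then 1 else - sgn C (w i).

Definition weyl_mean (f : 'I_d -> 'I_d -> C) (i k : 'I_d) : C :=
  #|weyl|%:R^-1 * \sum_(w in weyl) f (w i) (w k).

Lemma weyl_mean_orbit f v i k : v \in weyl ->
  weyl_mean f (v i) (v k) = weyl_mean f i k.
Proof.
move=> hv; congr (_ * _); rewrite [RHS](reindex_inj (mulgI v)) /=.
by apply: eq_big => w; rewrite ?weyl_mul // => _; rewrite !permM.
Qed.

Lemma weyl_mean_const f c i k : (forall w, w \in weyl -> f (w i) (w k) = c) ->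
  weyl_mean f i k = c.
Proof.
move=> h; rewrite /weyl_mean (eq_bigr (fun=> c)) //.
rewrite sumr_const -[c in LHS]mulr1 -mulrnAr mulrCA mulVf ?mulr1 //.
by rewrite pnatr_eq0 -lt0n; apply/card_gt0P; exists 1%g; exact: weyl1.
Qed.

Lemma eq_weyl_mean f g i k :
  (forall w, w \in weyl -> f (w i) (w k) = g (w i) (w k)) -> weyl_mean f i k = weyl_mean g i k.
Proof. by move=> h; congr (_ * _); apply: eq_bigr. Qed.

Definition star_swap (x y : 'I_d) : {perm 'I_d} :=
  if y == star x then tperm x y else (tperm x y * tperm (star x) (star y))%g.

Lemma star_swapL x y : star_swap x y x = y.
Proof.
rewrite /star_swap; case: eqP => [_|h]; rewrite ?permM tpermL //.
rewrite tpermD //; first by apply/eqP => e; apply: h.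
by rewrite star_neq.
Qed.

Lemma star_swapD x y z : z != x -> z != y -> z != star x -> z != star y ->
  star_swap x y z = z.
Proof.
move=> h1 h2 h3 h4; rewrite /star_swap.
by case: eqP => _; rewrite ?permM !tpermD // eq_sym.
Qed.

Lemma star_swap_weyl x y : star_swap x y \in weyl.
Proof.
apply/weylP => i; rewrite /star_swap; case: (eqVneq y (star x)) => [->|h].
  by rewrite (inj_tperm _ _ _ (star_inj d_even)) starK // tpermC.
set a := tperm x y; set b := tperm (star x) (star y).
have ha z : star (a z) = b (star z) by rewrite (inj_tperm _ _ _ (star_inj d_even)).
have hb z : star (b z) = a (star z).
  by rewrite (inj_tperm _ _ _ (star_inj d_even)) !starK.
have hc : commute a b.
  apply: (@perm_onC _ [set x; y] [set star x; star y]); rewrite ?tperm_on //.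
  rewrite finset.disjoints_subset; apply/subsetP => z; rewrite !inE => /orP[]/eqP->.
    by rewrite neq_star // -star_eqC // eq_sym (negPf h).
  by rewrite neq_star // (negPf h).
by rewrite !permM hb ha -[LHS]permM hc permM.
Qed.

Lemma weyl_transitive i i' : exists2 w, w \in weyl & w i = i'.
Proof. by exists (star_swap i i'); [exact: star_swap_weyl|exact: star_swapL]. Qed.

(** First move [i] to [i'], then swap the image of [k] with [k']; the swap fixes [i'], which differs
    from both and from their partners. *)
Lemma weyl_transitive2 i k i' k' : k != i -> k != star i -> k' != i' -> k' != star i' ->
  exists w, [/\ w \in weyl, w i = i' & w k = k'].
Proof.
move=> h1 h2 h3 h4; have [v hv vi] := weyl_transitive i i'.
have vst := weylP _ hv.
exists (v * star_swap (v k) k')%g; rewrite weyl_mul // star_swap_weyl !permM.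
rewrite star_swapL vi star_swapD // -vi.
- by rewrite (inj_eq perm_inj) eq_sym.
- by rewrite vi eq_sym.
- by rewrite -vst (inj_eq perm_inj) -star_eqC // eq_sym.
by rewrite vi -star_eqC // eq_sym.
Qed.

(** The restrictions of [X] to the three balanced patterns. The sign in [pair_part] is the one for
    which [symflip] restricts to the constant 1. *)
Definition diag_part (X : 'M[C]_(d * d)) (i k : 'I_d) := ent X i i k k.
Definition pop_part (X : 'M[C]_(d * d)) (i j : 'I_d) := ent X i j i j.
Definition pair_part (X : 'M[C]_(d * d)) (i j : 'I_d) :=
  - (sgn C i * sgn C j * ent X i j (star j) (star i)).

Lemma reach_weyl X : exists2 Y, reach X Y & forall i j k l, ent Y i j k l =
  if balanced i j k l then #|weyl|%:R^-1 * \sum_(w in weyl)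
     weyl_sign w i * weyl_sign w j * weyl_sign w k * weyl_sign w l *
     ent X (w i) (w j) (w k) (w l) else 0.
Proof.
have sr w i : (weyl_sign w i)^* = weyl_sign w i.
  by rewrite /weyl_sign; case: ifP; rewrite ?rmorphN ?rmorph1 //= conj_sgn.
have hS w : w \in weyl -> symplectic (monomx (weyl_sign w) w).
  move=> hw; have hst := weylP _ hw; apply: monomx_symplectic => // i; rewrite sr.
    by rewrite /weyl_sign; case: ifP; rewrite ?mulr1 // mulrNN sgn2.
  rewrite /weyl_sign hst star_lt // sgn_star // opprK [sgn C i]/sgn.
  by case: (i < d./2)%N; rewrite /= ?mulr1 ?mul1r // mulN1r mulrNN sgn2.
(* The default value [X] keeps every term in the hull; only Weyl elements are summed over. *)
pose F w := if w \in weyl then tw (monomx (weyl_sign w) w) X else X.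
have h0 : (0 < size (enum weyl))%N.
  by rewrite -cardE; apply/card_gt0P; exists 1%g; exact: weyl1.
have hr : reach X ((size (enum weyl))%:R^-1 *: \sum_(w <- enum weyl) F w).
  apply: reach_mean => // w; rewrite /F; case: ifP => hw; last exact: reach_refl.
  by apply: reach_tw; [exact: hS | exact: reach_refl].
have [Y hY hE] := reach_balanced ((size (enum weyl))%:R^-1 *: \sum_(w <- enum weyl) F w).
exists Y; first exact: reach_trans hY.
move=> i j k l; rewrite hE entZ -cardE; case: ifP => // _; congr (_ * _).
rewrite /ent summxE big_enum; apply: eq_bigr => w hw.
by rewrite /F hw -/(ent _ _ _ _ _) ent_tw_monomx !sr.
Qed.

End Weyl.

(** * Normal form after the torus and Weyl averages *)

Section NormalForm.
Context (C : numClosedFieldType) (d : nat) (d_even : ~~ odd d).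
Implicit Types (S : 'M[C]_d) (X Y Z : 'M[C]_(d * d)).

Definition unit_op (a b c e : 'I_d) : 'M[C]_(d * d) := ket2 C a b *m (ket2 C c e)^t*.

Lemma ent_unit_op a b c e i j k l :
  ent (unit_op a b c e) i j k l = [&& i == a, j == b, k == c & l == e]%:R.
Proof.
rewrite ent_proj !vent_ket2 rmorphM /= !conjC_nat -!natrM !mulnb.
by rewrite !andbA.
Qed.

(* The part of a torus- and Weyl-invariant matrix that is not Sp(d)-invariant. *)
Definition defect (a b c : C) : 'M[C]_(d * d) :=
  \sum_r (a *: unit_op r r r r + b *: unit_op r r (star r) (star r)
          + c *: unit_op r (star r) r (star r)).

Lemma ent_defect a b c i j k l :
  ent (defect a b c) i j k l = a * [&& j == i, k == i & l == i]%:R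
   + b * [&& j == i, k == star i & l == star i]%:R
   + c * [&& j == star i, k == i & l == star i]%:R.
Proof.
rewrite /ent /defect summxE.
rewrite -(sum_delta i (fun i => a * [&& j == i, k == i & l == i]%:R
   + b * [&& j == i, k == star i & l == star i]%:R
   + c * [&& j == star i, k == i & l == star i]%:R)).
apply: eq_bigr => r _; rewrite -/(ent _ _ _ _ _) !entD !entZ !ent_unit_op.
rewrite (eq_sym r i); case: (i == r) => //=; first by rewrite mul1r.
by rewrite !mulr0 !addr0 mul0r.
Qed.

Lemma weyl_sign2 (w : {perm 'I_d}) i : weyl_sign C w i * weyl_sign C w i = 1.
Proof. by rewrite /weyl_sign; case: ifP => _; rewrite ?mulr1 // mulrNN sgn2. Qed.

Lemma weyl_sign_star (w : {perm 'I_d}) i : w \in weyl d ->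
  weyl_sign C w i * weyl_sign C w (star i) = sgn C i * sgn C (w i).
Proof.
move=> hw; rewrite /weyl_sign (weylP _ hw) star_lt // sgn_star // opprK.
by rewrite [sgn C i]/sgn; case: (i < d./2)%N; rewrite /= ?mulr1 // mulN1r.
Qed.

(** The Weyl group has three orbits on ordered pairs: equal, partners, and generic. A Weyl mean
    therefore takes three values; this lemma and the next two identify them. *)
Lemma weyl_mean_far f i k i0 j0 : k != i -> k != star i -> j0 != i0 -> j0 != star i0 ->
  @weyl_mean C d f i k = weyl_mean f i0 j0.
Proof.
move=> h1 h2 h3 h4; have [w [hw <- <-]] := weyl_transitive2 d_even h1 h2 h3 h4.
by rewrite weyl_mean_orbit.
Qed.

Lemma weyl_mean_eq f i i0 : @weyl_mean C d f i i = weyl_mean f i0 i0.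
Proof.
by have [w hw <-] := weyl_transitive d_even i i0; rewrite weyl_mean_orbit.
Qed.

Lemma weyl_mean_star f i i0 : @weyl_mean C d f i (star i) = weyl_mean f i0 (star i0).
Proof.
have [w hw <-] := weyl_transitive d_even i i0.
by rewrite -(weylP _ hw) weyl_mean_orbit.
Qed.

Lemma weyl_mean_opp f i k : @weyl_mean C d (fun i k => - f i k) i k = - weyl_mean f i k.
Proof. by rewrite /weyl_mean sumrN mulrN. Qed.

(** The means over generic pairs give the coefficients of the three invariants. The patterns overlap
    only on equal and partner pairs, and the discrepancy left there is the defect. *)
Lemma reach_normal_form (i0 j0 : 'I_d) X : j0 != i0 -> j0 != star i0 ->
  let al := weyl_mean (pop_part X) i0 j0 in
  let be := weyl_mean (diag_part X) i0 j0 in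
  let ga := weyl_mean (pair_part X) i0 j0 in
  reach X (inv3 d al be ga +
    defect (weyl_mean (diag_part X) i0 i0 - al - be)
           (weyl_mean (diag_part X) i0 (star i0) - be + ga)
           (weyl_mean (pop_part X) i0 (star i0) - al - ga)).
Proof.
move=> hj hjs al be ga; have [Y hY hE] := reach_weyl d_even X.
rewrite (_ : _ + _ = Y) //; apply: ent_inj => i j k l; rewrite {}hE.
rewrite entD ent_inv3 // ent_defect.
case: ifP => [/or3P[]|].
- case/andP => /eqP<- /eqP<-.
  rewrite (eq_bigr (fun w : {perm 'I_d} => diag_part X (w i) (w k)))
    -?/(weyl_mean _ _ _); last first.
    by move=> w _; rewrite weyl_sign2 mul1r weyl_sign2 mul1r.
  rewrite (eq_sym i k) sgn2 !eqxx neq_star // andbb /= andbb.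
  case: (eqVneq k i) => [->|hk].
    by rewrite neq_star // (weyl_mean_eq _ i i0) /=; ring.
  case: (eqVneq k (star i)) => [->|hk'].
    by rewrite (weyl_mean_star _ i i0) /=; ring.
  by rewrite (weyl_mean_far _ hk hk' hj hjs) -/be /=; ring.
- case/andP => /eqP<- /eqP<-.
  rewrite (eq_bigr (fun w : {perm 'I_d} => pop_part X (w i) (w j)))
    -?/(weyl_mean _ _ _); last first.
    by move=> w _; rewrite (mulrAC _ (weyl_sign C w j) (weyl_sign C w i))
      weyl_sign2 mul1r weyl_sign2 mul1r.
  rewrite (eq_sym i j) !eqxx !(neq_star d_even) -!star_eqC //= !andbb andbF.
  rewrite (star_eqC d_even j) (eq_sym (star i)).
  case: (eqVneq j i) => [->|hk].
    rewrite neq_star //.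
    (* The population and diagonal patterns meet at j = i. *)
    have -> : weyl_mean (pop_part X) i i = weyl_mean (diag_part X) i i by exact: eq_weyl_mean.
    by rewrite (weyl_mean_eq _ i i0) /=; ring.
  case: (eqVneq j (star i)) => [->|hk'].
    by rewrite (weyl_mean_star _ i i0) sgn_star // mulrN sgn2 /=; ring.
  by rewrite (weyl_mean_far _ hk hk' hj hjs) -/al /=; ring.
- case/andP => /eqP-> /eqP->.
  rewrite (eq_bigr (fun w : {perm 'I_d} => 
    - (sgn C i * sgn C j) * pair_part X (w i) (w j))); last first.
    move=> w hw; rewrite /pair_part -!(weylP _ hw).
    transitivity ((weyl_sign C w i * weyl_sign C w (star i)) *
       (weyl_sign C w j * weyl_sign C w (star j)) * ent X (w i) (w j) (w (star j)) (w (star i))).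
      by ring.
    by rewrite !weyl_sign_star //; ring.
  rewrite -mulr_sumr [RHS]mulrCA -/(weyl_mean _ _ _).
  rewrite star_neq // !star_eq // !eqxx !andbF !andbT (eq_sym i j).
  rewrite (eq_sym i (star j)) (star_eqC d_even j) !andbb.
  (* The pair pattern meets the diagonal one, up to sign, at j = i, and the population one at j =
     star i. *)
  case: (eqVneq j i) => [->|hk].
    have -> : weyl_mean (pair_part X) i i = - weyl_mean (diag_part X) i (star i).
      rewrite -weyl_mean_opp; congr (_ * _); apply: eq_bigr => w hw.
      by rewrite /pair_part sgn2 mul1r (weylP _ hw).
    by rewrite neq_star // sgn2 (weyl_mean_star _ i i0) /=; ring.
  case: (eqVneq j (star i)) => [->|hk'].
    have -> : weyl_mean (pair_part X) i (star i) = weyl_mean (pop_part X) i (star i).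
      apply: eq_weyl_mean => w hw.
      by rewrite /pair_part (weylP _ hw) sgn_star // starK // mulrN sgn2 mulN1r opprK.
    by rewrite (weyl_mean_star _ i i0) sgn_star // mulrN sgn2 /=; ring.
  by rewrite (weyl_mean_far _ hk hk' hj hjs) -/ga /=; ring.
rewrite /balanced -!natrM !mulnb => /norP[/negPf hA /norP[/negPf hB /negPf hC]].
rewrite hA hB hC.
have -> : [&& j == i, k == i & l == i] = false.
  by apply/negP => /and3P[/eqP hh1 /eqP hh2 /eqP hh3]; rewrite hh1 hh2 hh3 !eqxx in hA.
have -> : [&& j == i, k == star i & l == star i] = false.
  by apply/negP => /and3P[/eqP hh1 /eqP hh2 /eqP hh3]; rewrite hh1 hh2 hh3 !eqxx in hA.
have -> : [&& j == star i, k == i & l == star i] = false.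
  by apply/negP => /and3P[/eqP hh1 /eqP hh2 /eqP hh3]; rewrite hh1 hh2 hh3 !eqxx in hB.
by rewrite !mulr0 subr0 !addr0.
Qed.
End NormalForm.

(** * The Fourier twirl *)

Section FourierTwirl.
Context (C : numClosedFieldType) (d : nat) (d_even : ~~ odd d).
Implicit Types (S : 'M[C]_d) (X Y Z : 'M[C]_(d * d)).

(** Replacing [k] by [star k] flips the sign product but stays within the generic orbit, so the
    oscillating part averages to zero. *)
Lemma weyl_mean_sgn (f : 'I_d -> 'I_d -> C) a b i0 j0 : j0 != i0 -> j0 != star i0 ->
  (forall i k, k != i -> k != star i -> f i k = a + b * (sgn C i * sgn C k)) ->
  weyl_mean f i0 j0 = a.
Proof.
move=> h1 h2 hf.
have e : weyl_mean f i0 (star j0) = weyl_mean f i0 j0.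
  by apply: weyl_mean_far => //; rewrite ?star_eq // star_eqC.
apply: (@mulIf _ 2%:R); rewrite ?pnatr_eq0 // [RHS]mulr_natr.
rewrite -(_ : weyl_mean (fun i k => f i k + f i (star k)) i0 j0 = a *+ 2).
  rewrite mulr_natr mulr2n -{2}e /weyl_mean -mulrDr -big_split /=; congr (_ * _).
  by apply: eq_bigr => w hw; rewrite (weylP _ hw).
apply: weyl_mean_const => w hw; have hs := weylP _ hw.
have A : w j0 != w i0 by rewrite (inj_eq perm_inj).
have B : w j0 != star (w i0) by rewrite -hs (inj_eq perm_inj).
rewrite (hf _ _ A B) hf ?star_eq // ?star_eqC // sgn_star //; ring.
Qed.

Section Fourier.
Context (z : C) (hz : (d./2).-primitive_root z).

Let q : C := (sqrtC d%:R)^-1.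

(** The block matrix (F F; -Fbar Fbar) / sqrt 2 of the overview. Indices need no reduction modulo
    d/2 in the exponents, as z^(d/2) = 1. *)
Definition fourier : 'M[C]_d := \matrix_(i, r)
  (q * (if (i < d./2)%N then z ^+ (i * r) else - sgn C r * z^* ^+ (i * r))).

Lemma star_root_expr (i r : 'I_d) (u : C) : u ^+ d./2 = 1 ->
  (u ^+ (star i * r) = u ^+ (i * r)) * (u ^+ (i * star r) = u ^+ (i * r)).
Proof.
move=> hu; have ud : u ^+ d = 1 by rewrite (even_halfE d_even) exprD hu mulr1.
have h (j : 'I_d) : u ^+ star j = u ^+ j by rewrite /= expr_mod // exprD hu mulr1.
split; first by rewrite exprM h -exprM.
by rewrite mulnC exprM h -exprM mulnC.
Qed.

Let z1 : z ^+ d./2 = 1. Proof. exact: prim_expr_order. Qed.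
Let zc1 : z^* ^+ d./2 = 1. Proof. by rewrite -rmorphXn z1 rmorph1. Qed.
Let zz : z * z^* = 1. Proof. exact: (unity_conj (prim_order_gt0 hz)). Qed.
Let d_gt0 : (0 < d)%N.
Proof. by have := prim_order_gt0 hz; rewrite (even_halfE d_even); lia. Qed.

Let qr : q^* = q.
Proof. by rewrite /q fmorphV /= conj_Creal // ger0_real // sqrtC_ge0 ler0n. Qed.
Let qq : q * q = d%:R^-1.
Proof. by rewrite /q -invfM -expr2 sqrtCK. Qed.

Let zzX (n : nat) : z ^+ n * z^* ^+ n = 1.
Proof. by rewrite -exprMn zz expr1n. Qed.

Lemma fourier_star i r : fourier (star i) (star r) = sgn C i * sgn C r * (fourier i r)^*.
Proof.
rewrite !mxE star_lt // !star_root_expr // sgn_star // rmorphM /= qr [sgn C i]/sgn.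
case: (i < d./2)%N; rewrite /= ?rmorphM ?rmorphN /= ?conj_sgn rmorphXn /= ?conjCK.
  by ring.
rewrite mulN1r mulrCA; congr (q * _).
by rewrite mulrA mulrNN sgn2 mul1r.
Qed.

Lemma fourier_flat i r : fourier i r * (fourier i r)^* = d%:R^-1.
Proof.
rewrite !mxE rmorphM /= qr mulrACA qq.
case: (i < d./2)%N; rewrite ?rmorphM ?rmorphN /= ?conj_sgn rmorphXn /= ?conjCK.
  by rewrite zzX mulr1.
by rewrite mulrACA mulrNN sgn2 mul1r mulrC -[z^* ^+ _ * _]mulrC zzX mul1r.
Qed.

(** Columns [r] and [star r] carry the same powers of z, so the phases cancel and only the sign of
    the row is left. *)
Lemma fourier_pair i r : fourier i r * (fourier i (star r))^* = sgn C i / d%:R.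
Proof.
rewrite !mxE rmorphM /= qr mulrACA qq mulrC; congr (_ / _).
rewrite [sgn C i]/sgn !star_root_expr //.
case: (i < d./2)%N; rewrite ?rmorphM ?rmorphN /= ?conj_sgn rmorphXn /= ?conjCK.
  by rewrite zzX.
by rewrite mulrACA sgn_star // opprK mulNr sgn2 mulrC -[z^* ^+ _ * _]mulrC zzX mul1r.
Qed.

(** Flatness gives the diagonal. For two distinct rows in the same half the product is a geometric
    sum over a nontrivial root of unity; for rows in different halves the terms at [r] and [star r]
    cancel. *)
Lemma fourier_unitary : fourier *m fourier^t* = 1%:M.
Proof.
apply/matrixP => i j; rewrite !mxE.
have hd : d%:R != 0 :> C by rewrite pnatr_eq0 -lt0n.
case: (eqVneq i j) => [<-|nij].
  transitivity (\sum_(k < d) (d%:R^-1 : C)).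
    by apply: eq_bigr => k _; rewrite -(fourier_flat i k) !mxE.
  by rewrite sumr_const card_ord -[LHS]mulr_natl mulfV.
set f := fun r => fourier i r * (fourier j r)^*.
transitivity (\sum_r f r); first by apply: eq_bigr => r _; rewrite /f !mxE.
have geo (u : C) : u ^+ d./2 = 1 -> u != 1 -> \sum_(r < d) u ^+ r = 0.
  move=> hu; have ud : u ^+ d = 1 by rewrite (even_halfE d_even) exprD hu mulr1.
  exact: sum_unity_root.
have root_neq1 (i' j' : 'I_d) : (i' %% d./2 != j' %% d./2)%N ->
    \sum_(r < d) (z ^+ i' * z^* ^+ j') ^+ r = 0.
  move=> hij; apply: geo; first by rewrite exprMn (exprAC z) z1 (exprAC z^*) zc1 !expr1n mulr1.
  have zj0 : z ^+ j' != 0.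
    by rewrite expf_neq0 //; apply: contra_eq_neq zz => ->; rewrite mul0r eq_sym oner_eq0.
  rewrite -(inj_eq (mulIf zj0)) -mulrA (mulrC _ (z ^+ j')) zzX mulr1 mul1r.
  by rewrite (eq_prim_root_expr hz).
have hodd : (forall r, f (star r) = - f r) -> \sum_r f r = 0.
  move=> hf; apply: (@mulIf _ 2%:R); rewrite ?pnatr_eq0 // mul0r mulr_natr mulr2n.
  rewrite {1}(reindex_inj (star_inj d_even))
    (eq_bigr (fun r => - f r)) => [|r _]; last exact: hf.
  by rewrite sumrN addNr.
have [ed li lj] : [/\ d = (d./2 + d./2)%N, (i < d)%N & (j < d)%N].
  by split; rewrite ?ltn_ord //; exact: even_halfE.
case: (ltnP i d./2) (ltnP j d./2) => hi [] hj.
- rewrite (eq_bigr (fun r : 'I_d => d%:R^-1 * (z ^+ i * z^* ^+ j) ^+ r)).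
    by rewrite -mulr_sumr root_neq1 ?mulr0 // !modn_small.
  move=> r _; rewrite /f !mxE hi hj rmorphM /= qr rmorphXn /= mulrACA qq.
  by rewrite exprMn -!exprM.
- apply: hodd => r; rewrite /f !mxE hi ltnNge hj /= !star_root_expr // sgn_star //.
  by rewrite !rmorphM /= !rmorphN /=; ring.
- apply: hodd => r; rewrite /f !mxE ltnNge hi hj /= !star_root_expr // sgn_star //.
  by rewrite !rmorphM /=; ring.
rewrite (eq_bigr (fun r : 'I_d => d%:R^-1 * (z ^+ j * z^* ^+ i) ^+ r)).
  rewrite -mulr_sumr root_neq1 ?mulr0 //.
  (* Lower rows are shifted by d/2 so that distinct indices give distinct residues modulo d/2. *)
  rewrite -(subnK hi) -(subnK hj) !modnDr !modn_small; try lia.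
  by apply: contra_neq nij => e; apply: ord_inj; lia.
move=> r _; rewrite /f !mxE !ltnNge hi hj /= !rmorphM /= !rmorphN /= conj_sgn qr
  rmorphXn /= conjCK.
rewrite mulrACA qq mulrACA mulrNN sgn2 mul1r exprMn -!exprM.
by rewrite [z ^+ _ * _]mulrC.
Qed.

Lemma fourier_symplectic : symplectic fourier.
Proof. exact: (symplectic_of_star d_even fourier_unitary fourier_star). Qed.

End Fourier.
End FourierTwirl.

(** * Elimination of the defects *)

Section InvariantMean.
Context (C : numClosedFieldType) (d : nat) (d_even : ~~ odd d).
Implicit Types (S T : 'M[C]_d) (X Y Z : 'M[C]_(d * d)).

Lemma ent_tw_unit_op S a b c e i j k l :
  ent (tw S (unit_op C a b c e)) i j k l = S i a * (S j b)^* * (S k c)^* * S l e.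
Proof.
have h u v i' j' : vent ((S *t map_mx Num.conj S) *m ket2 C u v) i' j' = S i' u * (S j' v)^*.
  rewrite /vent mxE sum_mxtens.
  rewrite -(sum_delta u (fun u => S i' u * (S j' v)^*)); apply: eq_bigr => a' _.
  rewrite -(sum_delta v (fun v => S i' a' * (S j' v)^*)) mulr_sumr; apply: eq_bigr => b' _.
  by rewrite tensmxE mxE -/(vent _ _ _) vent_ket2; ring.
have -> : tw S (unit_op C a b c e) = ((S *t map_mx Num.conj S) *m ket2 C a b) *m
   ((S *t map_mx Num.conj S) *m ket2 C c e)^t*.
  by rewrite /tw /unit_op adjmxM !mulmxA.
by rewrite ent_proj !h rmorphM /= conjCK; ring.
Qed.

Lemma ent_tw_defect S a b c i j k l :
  ent (tw S (defect d a b c)) i j k l = \sum_r (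
    a * (S i r * (S j r)^* * (S k r)^* * S l r) +
    b * (S i r * (S j r)^* * (S k (star r))^* * S l (star r)) +
    c * (S i r * (S j (star r))^* * (S k r)^* * S l (star r))).
Proof.
have -> : tw S (defect d a b c) = \sum_r (a *: tw S (unit_op C r r r r)
   + b *: tw S (unit_op C r r (star r) (star r))
   + c *: tw S (unit_op C r (star r) r (star r))).
  rewrite /defect /tw mulmx_sumr mulmx_suml; apply: eq_bigr => r _.
  by rewrite -/(tw _ _) !tw_add !tw_scale.
rewrite /ent summxE; apply: eq_bigr => r _.
by rewrite -/(ent _ _ _ _ _) !entD !entZ !ent_tw_unit_op.
Qed.

Section Flat.
Context (T : 'M[C]_d) (hT : symplectic T)
  (T_star : forall i r, T (star i) (star r) = sgn C i * sgn C r * (T i r)^*)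
  (T_flat : forall i r, T i r * (T i r)^* = d%:R^-1)
  (T_pair : forall i r, T i r * (T i (star r))^* = sgn C i / d%:R).

Let T_pair' i r : (T i r)^* * T i (star r) = sgn C i / d%:R.
Proof.
have /(congr1 Num.conj) := T_pair i r.
by rewrite !rmorphM /= conjCK conj_sgn fmorphV /= conjC_nat.
Qed.

Let sum_d (x : C) : (0 < d)%N -> \sum_(r < d) (x / (d%:R * d%:R)) = x / d%:R.
Proof.
move=> d0; rewrite sumr_const card_ord -[LHS]mulr_natl.
by field; rewrite pnatr_eq0 -lt0n.
Qed.

(** The four entries in each summand group into two products known from flatness and pairing, so the
    summand does not depend on [r]. The result is a constant plus a multiple of the sign product,
    which the Weyl mean removes. *)
Lemma diag_tw_defect a b c i k :
  ent (tw T (defect d a b c)) i i k k = (a + b + c * (sgn C i * sgn C k)) / d%:R.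
Proof.
have d0 : (0 < d)%N by exact: leq_ltn_trans (ltn_ord i).
have dn : d%:R != 0 :> C by rewrite pnatr_eq0 -lt0n.
rewrite ent_tw_defect -sum_d //; apply: eq_bigr => r _.
rewrite T_flat T_pair -!(mulrA _ (T k _)^*) T_pair' ![(T k _)^* * T k _]mulrC !T_flat.
by field.
Qed.

Lemma pop_tw_defect a b c i j :
  ent (tw T (defect d a b c)) i j i j = (a + c + b * (sgn C i * sgn C j)) / d%:R.
Proof.
have d0 : (0 < d)%N by exact: leq_ltn_trans (ltn_ord i).
have dn : d%:R != 0 :> C by rewrite pnatr_eq0 -lt0n.
rewrite ent_tw_defect -sum_d //; apply: eq_bigr => r _.
transitivity (a * ((T i r * (T i r)^*) * (T j r * (T j r)^*)) +
  b * ((T i r * (T i (star r))^*) * ((T j r)^* * T j (star r))) +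
  c * ((T i r * (T i r)^*) * (T j (star r) * (T j (star r))^*))); first by ring.
by rewrite !T_flat T_pair T_pair'; field.
Qed.

Let T_star1 i r : T i r * T (star i) (star r) = sgn C i * sgn C r / d%:R.
Proof. by rewrite T_star mulrCA T_flat. Qed.

Let T_star2 i r : T i r * T (star i) r = - sgn C r / d%:R.
Proof.
rewrite -{2}(starK d_even r) T_star mulrCA T_pair sgn_star //.
by transitivity (- (sgn C i * sgn C i) * sgn C r / d%:R); [ring|rewrite sgn2; ring].
Qed.

(** Here the entries pair up between rows [i] and [star i] without conjugation; the star relation
    reduces these products to the flat and paired ones. *)
Lemma pair_tw_defect a b c i j :
  pair_part (tw T (defect d a b c)) i j = (c - b - a * (sgn C i * sgn C j)) / d%:R.
Proof.
have d0 : (0 < d)%N by exact: leq_ltn_trans (ltn_ord i).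
have dn : d%:R != 0 :> C by rewrite pnatr_eq0 -lt0n.
have cs1 k r : (T k r)^* * (T (star k) (star r))^* = sgn C k * sgn C r / d%:R.
  by rewrite -rmorphM T_star1 !rmorphM /= !conj_sgn fmorphV /= conjC_nat.
have cs2 k r : (T k r)^* * (T (star k) r)^* = - sgn C r / d%:R.
  by rewrite -rmorphM T_star2 !rmorphM rmorphN /= !conj_sgn fmorphV /= conjC_nat.
have ss := sgn2 C i; have sj := sgn2 C j.
rewrite /pair_part ent_tw_defect -sum_d // mulr_sumr -sumrN; apply: eq_bigr => r _.
have sr := sgn2 C r.
transitivity (- (sgn C i * sgn C j * (
  a * ((T i r * T (star i) r) * ((T j r)^* * (T (star j) r)^*)) +
  b * ((T i r * T (star i) (star r)) * ((T j r)^* * (T (star j) (star r))^*)) +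
  c * ((T i r * T (star i) (star r)) * ((T j (star r))^* * (T (star j) r)^*))))).
  by ring.
have -> : (T j (star r))^* * (T (star j) r)^* = - sgn C j * sgn C r / d%:R.
  by rewrite -{2}(starK d_even r) cs1 sgn_star // mulrN mulNr.
rewrite T_star1 T_star2 cs1 cs2.
transitivity (( c * ((sgn C i * sgn C i) * (sgn C j * sgn C j) * (sgn C r * sgn C r))
   - b * ((sgn C i * sgn C i) * (sgn C j * sgn C j) * (sgn C r * sgn C r))
   - a * (sgn C i * sgn C j) * (sgn C r * sgn C r)) / (d%:R * d%:R)); first by field.
by rewrite ss sj sr; congr (_ / _); ring.
Qed.

End Flat.

(** Average, apply the Fourier matrix, average again: the defect (p, q, r) becomes -(p, q, r)/d, so
    a suitable mean of both averages has none. *)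
Lemma reach_inv3 X : (2 < d)%N ->
  exists al be ga, reach X (inv3 d al be ga).
Proof.
move=> d2; have d0 : (0 < d)%N by lia.
have d1 : (1 < d)%N by lia.
have dn : d%:R != 0 :> C by rewrite pnatr_eq0 -lt0n.
have dn1 : d%:R + 1 != 0 :> C by rewrite natr1 pnatr_eq0.
pose i0 : 'I_d := Ordinal d0; pose j0 : 'I_d := Ordinal d1.
(* The indices 0 and 1 form a generic pair because the partner of 0 is d/2, which is at least 2. *)
have ji : j0 != i0 by [].
have jsi : j0 != star i0.
  apply/eqP => /(congr1 (@nat_of_ord d)); rewrite star_val //=.
  by have := even_halfE d_even; case: ifP => /=; lia.
have h0 : (0 < d./2)%N by have := even_halfE d_even; lia.
have [z hz] := @prim_root_exists C _ h0.
have Tsym := fourier_symplectic d_even hz.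
have Tstar := fourier_star d_even hz.
have Tflat := fourier_flat hz.
have Tpair := fourier_pair d_even hz.
set T := fourier d z in Tsym Tstar Tflat Tpair.
have [al [be [ga [p [q [r hX]]]]]] : exists al be ga p q r,
    reach X (inv3 d al be ga + defect d p q r).
  by do 6 eexists; exact: reach_normal_form ji jsi.
set Y := inv3 d al be ga + defect d p q r in hX.
have hTY : reach Y (tw T Y) by apply: reach_tw => //; exact: reach_refl.
have entTY i j k l : ent (tw T Y) i j k l = ent (inv3 d al be ga) i j k l
    + ent (tw T (defect d p q r)) i j k l.
  by rewrite tw_add tw_inv3 // entD.
have far (f : 'I_d -> 'I_d -> C) a b := @weyl_mean_sgn C d d_even f a b i0 j0 ji jsi.
have := reach_normal_form d_even (tw T Y) ji jsi.
(* The generic means come first, as constant part plus sign part; the means over equal and partner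
   pairs follow. *)
rewrite (far (pop_part _) (al + (p + r) / d%:R) (q / d%:R)); last first.
  move=> i k ki ksi; rewrite /pop_part entTY ent_inv3 // pop_tw_defect //.
  by rewrite (eq_sym i k) (negPf ki) !eqxx -(star_eqC d_even) (eq_sym _ k) (negPf ksi) /=; field.
rewrite (far (diag_part _) (be + (p + q) / d%:R) (r / d%:R)); last first.
  move=> i k ki ksi; rewrite /diag_part entTY ent_inv3 // diag_tw_defect //.
  by rewrite (eq_sym i k) (negPf ki) !eqxx (negPf ksi) /=; field.
rewrite (far (pair_part _) (ga + (r - q) / d%:R) (- p / d%:R)); last first.
  move=> i k ki ksi; rewrite /pair_part entTY mulrDr opprD.
  rewrite -[X in _ + X]/(pair_part (tw T (defect d p q r)) i k) pair_tw_defect //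
    ent_inv3 // (eq_sym i k) (negPf ki) (negPf ksi) !eqxx.
  transitivity (ga * ((sgn C i * sgn C i) * (sgn C k * sgn C k)) +
    (r - q - p * (sgn C i * sgn C k)) / d%:R); first by rewrite /=; field.
  by rewrite !sgn2; field.
rewrite (weyl_mean_const (c := al + be + (p + q + r) / d%:R)); last first.
  move=> w hw; rewrite /diag_part entTY ent_inv3 // diag_tw_defect // sgn2.
  by rewrite !eqxx neq_star //=; field.
rewrite (weyl_mean_const (c := be - ga + (p + q - r) / d%:R)); last first.
  move=> w hw; rewrite (weylP _ hw) /diag_part entTY ent_inv3 // diag_tw_defect //.
  by rewrite !eqxx neq_star // sgn_star // mulrN !sgn2 /=; field.
rewrite (weyl_mean_const (c := al + ga + (p + r - q) / d%:R)); last first.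
  move=> w hw; rewrite (weylP _ hw) /pop_part entTY ent_inv3 // pop_tw_defect //.
  by rewrite starK // !eqxx neq_star // sgn_star // mulrN !sgn2 /=; field.
move=> /= hY'; set Y' := (Q in reach _ Q) in hY'.
have hXY' : reach X Y' by apply: reach_trans hY'; apply: reach_trans hTY.
(* The weights 1/(d+1) and d/(d+1) make a defect and -1/d times it cancel. *)
have a0 : 0 <= (d%:R + 1)^-1 :> C by rewrite natr1 invr_ge0 ler0n.
have a1 : (d%:R + 1)^-1 <= 1 :> C by rewrite natr1 invf_le1 ?ltr0n // ler1n.
have := reach_conv a0 a1 hX hXY'; set M := _ + _ => hM.
exists ((d%:R + 1)^-1 * al + (1 - (d%:R + 1)^-1) * (al + (p + r) / d%:R)).
exists ((d%:R + 1)^-1 * be + (1 - (d%:R + 1)^-1) * (be + (p + q) / d%:R)).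
exists ((d%:R + 1)^-1 * ga + (1 - (d%:R + 1)^-1) * (ga + (r - q) / d%:R)).
rewrite (_ : inv3 _ _ _ _ = M) //; apply: ent_inj => i j k l.
rewrite [LHS]ent_inv3 // /M entD !entZ !(entD (inv3 _ _ _ _) (defect _ _ _ _)).
rewrite !ent_inv3 // !ent_defect.
by field; rewrite dn1 dn.
Qed.
End InvariantMean.

(** * Schmidt number *)

Section Mixture.
Context (C : numClosedFieldType) (d : nat).
Implicit Types (S : 'M[C]_d) (X Y Z rho : 'M[C]_(d * d)).

Lemma schmidt_mixture_mono rho j k :
  (j <= k)%N -> schmidt_mixture rho j -> schmidt_mixture rho k.
Proof.
move=> jk [n [p [xi [h1 h2 h3 h4 h5]]]]; exists n, p, xi; split=> // t.
by have [r hr hs] := h4 t; exists r => //; exact: leq_trans jk.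
Qed.

Lemma schmidt_mixture_pure (xi : 'cV[C]_(d * d)) k :
  (xi^t* *m xi) 0 0 = 1 -> is_schmidt_rank xi k -> schmidt_mixture (xi *m xi^t*) k.
Proof.
move=> h1 h2; exists 1%N, (fun=> 1), (fun=> xi); split=> //.
- by rewrite big_ord1.
- by move=> _; exists k.
by rewrite big_ord1 scale1r.
Qed.

Lemma schmidt_rank_local xi r (A B : 'M[C]_d) :
  A^t* *m A = 1%:M -> B^t* *m B = 1%:M -> is_schmidt_rank xi r ->
  is_schmidt_rank ((A *t B) *m xi) r.
Proof.
move=> hA hB [lam [e [f [h1 he hf ->]]]].
exists lam, (fun t => A *m e t), (fun t => B *m f t); split=> //.
- by move=> s t; rewrite adjmxM mulmxA -(mulmxA _ _ A) hA mulmx1 he.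
- by move=> s t; rewrite adjmxM mulmxA -(mulmxA _ _ B) hB mulmx1 hf.
rewrite mulmx_sumr; apply: eq_bigr => t _.
by rewrite -scalemxAr; congr (_ *: _); exact: (tensmx_mul A B (e t) (f t)).
Qed.

Lemma schmidt_mixture_tw rho k S :
  symplectic S -> schmidt_mixture rho k -> schmidt_mixture (tw S rho) k.
Proof.
move=> hS [n [p [xi [h1 h2 h3 h4 ->]]]].
have hU := mulmx1C (tens_conj_unit hS).
exists n, p, (fun t => (S *t map_mx Num.conj S) *m xi t); split=> //.
- by move=> t; rewrite adjmxM mulmxA -(mulmxA _ _ (S *t _)) hU mulmx1 h3.
- move=> t; have [r hr hs] := h4 t; exists r => //; apply: schmidt_rank_local hs.
    exact: symplectic_unitV.
  by rewrite map_trmx map_conjK symplectic_conj_unitV.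
rewrite /tw mulmx_sumr mulmx_suml; apply: eq_bigr => t _.
by rewrite -scalemxAr -scalemxAl adjmxM !mulmxA.
Qed.

Lemma schmidt_mixture_conv a X Y k : 0 <= a -> a <= 1 ->
  schmidt_mixture X k -> schmidt_mixture Y k ->
  schmidt_mixture (a *: X + (1 - a) *: Y) k.
Proof.
move=> a0 a1 [n [p [xi [h1 h2 h3 h4 ->]]]] [n' [p' [xi' [h1' h2' h3' h4' ->]]]].
exists (n + n')%N, (fun t => match split t with inl i => a * p i | inr j => (1 - a) * p' j end).
exists (fun t => match split t with inl i => xi i | inr j => xi' j end).
have sl i : split (lshift n' i) = inl i by rewrite -[lshift _ _]/(unsplit (inl i)) unsplitK.
have sr i : split (rshift n i) = inr i by rewrite -[rshift _ _]/(unsplit (inr i)) unsplitK.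
split.
- by move=> t; case: split => i; rewrite mulr_ge0 // subr_ge0.
- rewrite big_split_ord /= (eq_bigr (fun i => a * p i)) => [|i _]; last by rewrite sl.
  rewrite [X in _ + X](eq_bigr (fun i => (1 - a) * p' i)) => [|i _]; last by rewrite sr.
  by rewrite -!mulr_sumr h2 h2' !mulr1 addrC subrK.
- by move=> t; case: split.
- by move=> t; case: split.
rewrite big_split_ord /=; congr (_ + _); rewrite scaler_sumr; apply: eq_bigr => i _.
  by rewrite sl scalerA.
by rewrite sr scalerA.
Qed.

(** Both generating steps of [reach], a local unitary and a convex combination, preserve the bound
    on Schmidt ranks. *)
Lemma schmidt_mixture_reach X Y k : reach X Y -> schmidt_mixture X k -> schmidt_mixture Y k.
Proof.
move=> hr hX; elim: hr => {Y} // [S Y hS _ ih|a Y Z a0 a1 _ hY _ hZ].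
  exact: schmidt_mixture_tw.
exact: schmidt_mixture_conv.
Qed.

(** The quantities p and, for even d, w of the overview, written as sums over the balanced
    patterns. *)
Definition diag_sum X : C := \sum_i \sum_k diag_part X i k.
Definition pair_sum X : C := \sum_i \sum_j pair_part X i j.

Lemma mxtrace_ent X Y : \tr (X *m Y) =
  \sum_i \sum_j \sum_k \sum_l ent X i j k l * ent Y k l i j.
Proof.
rewrite /mxtrace sum_mxtens; apply: eq_bigr => i _; apply: eq_bigr => j _.
by rewrite mxE sum_mxtens.
Qed.

Lemma diag_sumE X : diag_sum X = \tr ((maxent C d *m (maxent C d)^t*) *m X).
Proof.
rewrite mxtrace_ent /diag_sum exchange_big; apply: eq_bigr => i _.
rewrite -[LHS](sum_delta i (fun j => \sum_k diag_part X k i)); apply: eq_bigr => j _.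
rewrite mulr_sumr; apply: eq_bigr => k _.
rewrite -(sum_delta k (fun l => (j == i)%:R * diag_part X k i)); apply: eq_bigr => l _.
rewrite ent_proj !vent_maxent conjC_nat (eq_sym l) (eq_sym j).
by case: (eqVneq i j) => [<-|]; case: (eqVneq k l) => [<-|]; rewrite ?mul0r ?mulr0 ?mul0r ?mul1r.
Qed.

Lemma pair_sumE (d_even : ~~ odd d) X : pair_sum X = \tr (symflip C d *m X).
Proof.
rewrite mxtrace_ent /pair_sum.
rewrite (reindex_inj (star_inj d_even)) exchange_big (reindex_inj (star_inj d_even)) /=.
apply: eq_bigr => i _; apply: eq_bigr => j _.
rewrite /pair_part !sgn_star // mulrNN !starK //.
rewrite -(sum_delta (star j) (fun k => - (sgn C j * sgn C i * ent X k (star i) i j))).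
apply: eq_bigr => k _.
rewrite -(sum_delta (star i) (fun l => - (sgn C j * sgn C i * ent X k l i j))) mulr_sumr.
apply: eq_bigr => l _; rewrite ent_symflip //; ring.
Qed.

Lemma reach_diag_sum X Y : reach X Y -> diag_sum Y = diag_sum X.
Proof.
rewrite !diag_sumE; apply: reach_tr => T hT.
have := tw_inv3 0 1 0 hT; rewrite /inv3 !scale0r scale1r add0r addr0 //.
Qed.

Lemma reach_pair_sum X Y : ~~ odd d -> reach X Y -> pair_sum Y = pair_sum X.
Proof.
move=> d_even; rewrite !pair_sumE //; apply: reach_tr => T hT.
have := tw_inv3 0 0 1 hT; rewrite /inv3 !scale0r scale1r !add0r //.
Qed.

Lemma reach_mxtrace X Y : reach X Y -> \tr Y = \tr X.
Proof.
move=> h; rewrite -(mul1mx Y) -(mul1mx X); apply: reach_tr h => T hT.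
have := tw_inv3 1 0 0 hT; rewrite /inv3 !scale0r scale1r !addr0 //.
Qed.

Lemma mxtrace_entE X : \tr X = \sum_i \sum_j ent X i j i j.
Proof. by rewrite /mxtrace sum_mxtens. Qed.

Lemma mxtrace_inv3 a b c : ~~ odd d -> \tr (inv3 d a b c : 'M[C]_(d * d)) =
  d%:R * (d%:R * a + b + c).
Proof.
move=> d_even; rewrite mxtrace_entE.
transitivity (\sum_(i < d) (d%:R * a + b + c)); last first.
  by rewrite sumr_const card_ord -[LHS]mulr_natl.
apply: eq_bigr => i _.
transitivity (\sum_j (a + ((j == i)%:R * b + (j == star i)%:R * c))).
  apply: eq_bigr => j _; rewrite ent_inv3 // !eqxx (eq_sym i j) -(star_eqC d_even j).
  rewrite (eq_sym (star j) i); case: (eqVneq j (star i)) => [->|nj].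
    by rewrite starK // eqxx star_neq // sgn_star // mulrN sgn2 /=; ring.
  by rewrite -(star_eqC d_even) (eq_sym _ j) (negPf nj); case: (j == i) => /=; ring.
by rewrite !big_split /= !sum_delta sumr_const card_ord -[a *+ d]mulr_natl addrA.
Qed.

Lemma diag_sum_inv3 a b c : ~~ odd d -> diag_sum (inv3 d a b c : 'M[C]_(d * d)) =
  d%:R * (a + d%:R * b - c).
Proof.
move=> d_even; rewrite /diag_sum.
transitivity (\sum_(i < d) (a + d%:R * b - c)); last first.
  by rewrite sumr_const card_ord -[LHS]mulr_natl.
apply: eq_bigr => i _.
transitivity (\sum_j (b + ((j == i)%:R * a + (j == star i)%:R * (- c)))).
  apply: eq_bigr => j _; rewrite /diag_part ent_inv3 // !eqxx (eq_sym i j) sgn2.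
  by case: (j == i); case: (j == star i) => /=; ring.
rewrite !big_split /= !sum_delta sumr_const card_ord -[b *+ d]mulr_natl; ring.
Qed.

Lemma pair_sum_inv3 a b c : ~~ odd d -> pair_sum (inv3 d a b c : 'M[C]_(d * d)) =
  d%:R * (a - b + d%:R * c).
Proof.
move=> d_even; rewrite /pair_sum.
transitivity (\sum_(i < d) (a - b + d%:R * c)); last first.
  by rewrite sumr_const card_ord -[LHS]mulr_natl.
apply: eq_bigr => i _.
transitivity (\sum_j (c + ((j == i)%:R * (- b) + (j == star i)%:R * a))).
  apply: eq_bigr => j _; rewrite /pair_part ent_inv3 // !eqxx star_eq // (eq_sym i j).
  rewrite -(star_eqC d_even i) (eq_sym _ j).
  have s1 : sgn C i * sgn C j * (sgn C i * sgn C j) = 1.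
    by rewrite mulrACA !sgn2 mulr1.
  rewrite mulrBr (mulrCA (sgn C i * sgn C j) c)
    (mulrA (sgn C i * sgn C j) (sgn C i * sgn C j)) s1.
  case: (eqVneq j i) => [->|nj].
    by rewrite neq_star // sgn2 /=; ring.
  case: (eqVneq j (star i)) => [->|nsj]; last by rewrite /=; ring.
  by rewrite sgn_star // mulrN sgn2 /=; ring.
rewrite !big_split /= !sum_delta sumr_const card_ord -[c *+ d]mulr_natl; ring.
Qed.

(** After division by d, trace, p and w form a linear system in (a, b, c) of determinant (d - 2)(d +
    1)^2, nonzero for d > 2. *)
Lemma inv3_eq a b c a' b' c' : ~~ odd d -> (2 < d)%N ->
  let X := inv3 d a b c : 'M[C]_(d * d) in let Y := inv3 d a' b' c' in
  \tr X = \tr Y -> diag_sum X = diag_sum Y -> pair_sum X = pair_sum Y -> X = Y.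
Proof.
move=> d_even d2 X Y; rewrite /X /Y !mxtrace_inv3 // !diag_sum_inv3 // !pair_sum_inv3 //.
have dn : d%:R != 0 :> C by rewrite pnatr_eq0; lia.
move=> /(mulfI dn) h1 /(mulfI dn) h2 /(mulfI dn) h3.
have ea : a = a'.
  have hk : (d%:R - 2%:R) * (d%:R + 1) != 0 :> C.
    by rewrite mulf_neq0 // ?natr1 ?pnatr_eq0 // -natrB ?pnatr_eq0; lia.
  have hk1 : d%:R + 1 != 0 :> C by rewrite natr1 pnatr_eq0.
  have hab : a + b = a' + b'.
    apply: (mulfI hk1); transitivity ((d%:R * a + b + c) + (a + d%:R * b - c)); first by ring.
    by rewrite h1 h2; ring.
  apply: (mulfI hk).
  transitivity (d%:R * (d%:R * a + b + c) - (a - b + d%:R * c) - (d%:R + 1) * (a + b));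
    first by ring.
  by rewrite h1 h3 hab; ring.
have hk1 : d%:R + 1 != 0 :> C by rewrite natr1 pnatr_eq0.
have eb : b = b'.
  apply: (mulfI hk1); transitivity ((d%:R * a + b + c) + (a + d%:R * b - c) - (d%:R + 1) * a);
    first by ring.
  by rewrite h1 h2 ea; ring.
have ec : c = c' by move: h1; rewrite ea eb => /addrI.
by rewrite ea eb ec.
Qed.

End Mixture.

(** * The overlap inequality for bounded rank *)

Section Witness.
Context (C : numClosedFieldType) (d : nat) (d_even : ~~ odd d).
Implicit Types (rho : 'M[C]_(d * d)) (xi : 'cV[C]_(d * d)).

Lemma frobenius_ge0 m n (A : 'M[C]_(m, n)) : 0 <= \tr (A^t* *m A).
Proof.
apply: sumr_ge0 => i _; rewrite mxE; apply: sumr_ge0 => j _.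
by rewrite !mxE mulrC mul_conjC_ge0.
Qed.

Lemma mxtrace_adj n (A : 'M[C]_n) : \tr (A^t*) = (\tr A)^*.
Proof. by rewrite /mxtrace rmorph_sum; apply: eq_bigr => i _; rewrite !mxE. Qed.

Lemma adjmxD m n (A B : 'M[C]_(m, n)) : (A + B)^t* = A^t* + B^t*.
Proof. by rewrite linearD map_mxD. Qed.

Lemma adjmxB m n (A B : 'M[C]_(m, n)) : (A - B)^t* = A^t* - B^t*.
Proof. by rewrite linearB /= map_mxB. Qed.

Lemma adjmxZ m n a (A : 'M[C]_(m, n)) : (a *: A)^t* = a^* *: A^t*.
Proof. by apply/matrixP => i j; rewrite !mxE rmorphM. Qed.

Lemma trmx_conj m n (A : 'M[C]_(m, n)) : A^T^t* = A^t*^T.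
Proof. by apply/matrixP => i j; rewrite !mxE. Qed.

(* The antisymmetric part Z of the coefficient matrix satisfies (1 - P) Z = (1 - P) Z P^T, P being
   the projector on the range of Y; hence Omega may be replaced by N, whose Frobenius norm is
   controlled by the rank of P. *)
Lemma antisym_overlap_le r (Y : 'M[C]_d) (E : 'M[C]_(d, r)) (G : 'M[C]_(r, d)) :
  E^t* *m E = 1%:M -> Y = E *m G ->
  r%:R * (\tr (Y *m Omega C d) * (\tr (Y *m Omega C d))^*) *+ 2 <=
  r%:R ^+ 2 * \tr ((Y - Y^T)^t* *m (Y - Y^T)).
Proof.
move=> hE hY; set O := Omega C d; set Z := Y - Y^T; set tau := \tr (Y *m O).
pose P := E *m E^t*.
have Padj : P^t* = P by rewrite /P adjmxM adjmxK.
have PP : P *m P = P by rewrite /P mulmxA -(mulmxA E) hE mulmx1.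
have PY : P *m Y = Y by rewrite hY /P mulmxA -(mulmxA E) hE mulmx1.
have PTadj : P^T^t* = P^T by rewrite trmx_conj Padj.
have PPT : P^T *m P^T = P^T by rewrite -trmx_mul PP.
have trP : \tr P = r%:R by rewrite /P mxtrace_mulC hE mxtrace1.
have OO : O *m O = - 1%:M by exact: Omega2.
have Oadj : O^t* = - O by exact: Omega_adj.
have OT : O^T = - O by exact: Omega_tr.
clearbody O P.
(* [N] may replace Omega in the pairing with Z: the part of Z outside the range of P is unchanged by
   [P^T] on the right. *)
pose N := O *m P + P^T *m O *m (1%:M - P).
have trZO : \tr (Z *m O) = tau *+ 2.
  rewrite /Z mulmxBl mxtraceD linearN /= -[\tr (Y^T *m O)]mxtrace_tr trmx_mul trmxK.
  by rewrite OT mulNmx linearN /= opprK [\tr (O *m Y)]mxtrace_mulC -mulr2n.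
have qY : (1%:M - P) *m Y = 0 by rewrite mulmxBl mul1mx PY subrr.
have qZ : (1%:M - P) *m Z *m P^T = (1%:M - P) *m Z.
  rewrite /Z !mulmxBr qY !sub0r mulNmx -mulmxA; congr (- (_ *m _)).
  by rewrite -trmx_mul PY.
have trZN : \tr (Z *m N) = tau *+ 2.
  rewrite -trZO /N mulmxDr mxtraceD.
  have -> : \tr (Z *m (P^T *m O *m (1%:M - P))) = \tr ((1%:M - P) *m Z *m O).
    by rewrite -qZ -!mulmxA [RHS]mxtrace_mulC !mulmxA.
  rewrite mulmxA mxtrace_mulC mulmxA -mxtraceD -mulmxDl -mulmxDl.
  by rewrite addrC subrK mul1mx.
(* The two terms of [N] are orthogonal because P (1 - P) = 0; the first has squared norm r, the
   second at most r. *)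
have N2 : \tr (N *m N^t*) <= r%:R *+ 2.
  have qadj : (1%:M - P)^t* = 1%:M - P.
    by rewrite adjmxB Padj; congr (_ - _); rewrite trmx1 map_mx1.
  have qq : (1%:M - P) *m (1%:M - P) = 1%:M - P.
    by rewrite mulmxBr mulmx1 mulmxBl mul1mx PP subrr subr0.
  have qP : P *m (1%:M - P) = 0 by rewrite mulmxBr mulmx1 PP subrr.
  have Pq : (1%:M - P) *m P = 0 by rewrite mulmxBl mul1mx PP subrr.
  rewrite /N; have [Q PQ] : exists Q, Q = 1%:M - P by exists (1%:M - P).
  rewrite -PQ in qadj qq qP Pq *.
  rewrite adjmxD !adjmxM qadj PTadj Padj mulmxDl !mulmxDr !mxtraceD.
  have -> : O *m P *m (Q *m (O^t* *m P^T)) = 0.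
    by rewrite !mulmxA -(mulmxA O) qP mulmx0 !mul0mx.
  have -> : P^T *m O *m Q *m (P *m O^t*) = 0.
    by rewrite -!mulmxA (mulmxA Q) Pq mul0mx !mulmx0.
  have -> : \tr (O *m P *m (P *m O^t*)) = r%:R.
    by rewrite mulmxA -(mulmxA O) PP mxtrace_mulC mulmxA Oadj mulNmx OO opprK mul1mx.
  rewrite linear0 addr0 add0r mulr2n lerD2l.
  have -> : \tr (P^T *m O *m Q *m (Q *m (O^t* *m P^T))) =
    r%:R - \tr ((P *m O^t* *m P^T)^t* *m (P *m O^t* *m P^T)).
    rewrite (mulmxA (P^T *m O *m Q) Q) -(mulmxA (P^T *m O) Q Q) qq PQ
      mulmxBr mulmx1 mulmxBl mxtraceD linearN /=.
    congr (_ - _).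
      rewrite mulmxA -(mulmxA _ O) Oadj mulmxN OO opprK mulmx1 PPT.
      by rewrite mxtrace_tr trP.
    rewrite !adjmxM adjmxK PTadj Padj -!mulmxA (mulmxA P P) PP.
    by congr (\tr (_ *m (_ *m _))).
  by rewrite gerBl frobenius_ge0.
clearbody Z N tau.
(* Cauchy-Schwarz for Z and the adjoint of [N], as the nonnegativity of the norm of one combination;
   no division by r occurs. *)
pose W := r%:R *: Z - tau *: N^t*.
have trNZ : \tr (N *m Z) = tau *+ 2 by rewrite mxtrace_mulC.
have := frobenius_ge0 W.
have -> : \tr (W^t* *m W) = r%:R ^+ 2 * \tr (Z^t* *m Z) - r%:R * (tau * tau^*) *+ 4
    + tau * tau^* * \tr (N *m N^t*).
  rewrite /W adjmxB !adjmxZ adjmxK mulmxBl !mulmxBr !linearB /=.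
  rewrite -!scalemxAl -!scalemxAr !mxtraceZ trNZ.
  have -> : \tr (Z^t* *m N^t*) = (tau *+ 2)^* by rewrite -adjmxM mxtrace_adj trNZ.
  by rewrite conjC_nat rmorphMn /=; ring.
move=> h; have h2 : tau * tau^* * \tr (N *m N^t*) <= tau * tau^* * (r%:R *+ 2).
  by rewrite ler_wpM2l // mul_conjC_ge0.
have {h2}h := le_trans h (lerD (lexx _) h2).
rewrite -subr_ge0; apply: le_trans h _; rewrite le_eqVlt; apply/orP; left.
by apply/eqP; ring.
Qed.

End Witness.

(** * Schmidt number in the (p, w)-plane *)

Section Region.
Context (C : numClosedFieldType) (d : nat) (d_even : ~~ odd d).
Implicit Types (rho X : 'M[C]_(d * d)) (xi : 'cV[C]_(d * d)).

Lemma norm_vent xi : (xi^t* *m xi) 0 0 = \sum_i \sum_j vent xi i j * (vent xi i j)^*.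
Proof.
rewrite mxE sum_mxtens; apply: eq_bigr => i _; apply: eq_bigr => j _.
by rewrite !mxE mulrC.
Qed.

(** With M the coefficient matrix and Y = M Omega one has |tr (Y Omega)|^2 = |tr M|^2 = p and |Y -
    Y^T|^2 = 2 (1 - w). The overlap inequality then reads 2 r p <= 2 r^2 (1 - w), and r > 0 for a
    unit vector. *)
Lemma schmidt_rank_witness xi r :
  (xi^t* *m xi) 0 0 = 1 -> is_schmidt_rank xi r ->
  diag_sum (xi *m xi^t*) <= r%:R * (1 - pair_sum (xi *m xi^t*)) /\
  pair_sum (xi *m xi^t*) <= 1.
Proof.
move=> nxi [lam [e [f [hlam he hf hxi]]]].
pose M : 'M[C]_d := \matrix_(i, j) vent xi i j.
pose E : 'M[C]_(d, r) := \matrix_(i, t) e t i 0.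
pose G : 'M[C]_(r, d) := \matrix_(t, j) (lam t * f t j 0).
have hE : E^t* *m E = 1%:M.
  apply/matrixP => s t; rewrite [RHS]mxE -he !mxE; apply: eq_bigr => i _.
  by rewrite !mxE.
have hM : M = E *m G.
  apply/matrixP => i j; rewrite !mxE hxi vent_sum; apply: eq_bigr => t _.
  by rewrite ventZ vent_tens !mxE mulrCA mulrA.
set O := Omega C d; pose Y := M *m O.
have YE i j : Y i j = - sgn C j * vent xi i (star j).
  rewrite !mxE -(sum_delta (star j) (fun k => - sgn C j * vent xi i k)).
  apply: eq_bigr => k _; rewrite mxE OmegaE // -(star_eqC d_even j k) (eq_sym (star j)).
  by case: eqP => [->|_]; rewrite ?mulr0 ?mul0r // sgn_star //; ring.
have hY : Y = E *m (G *m O) by rewrite mulmxA -hM.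
have trY : \tr (Y *m O) = - \tr M.
  by rewrite /Y -mulmxA Omega2 // mulmxN mulmx1 linearN.
have dE : diag_sum (xi *m xi^t*) = \tr M * (\tr M)^*.
  rewrite /diag_sum /mxtrace rmorph_sum mulr_suml; apply: eq_bigr => i _.
  by rewrite mulr_sumr; apply: eq_bigr => j _; rewrite /diag_part ent_proj !mxE.
have pE : pair_sum (xi *m xi^t*) = \sum_i \sum_j Y i j * (Y j i)^*.
  rewrite /pair_sum; apply: eq_bigr => i _.
  rewrite (reindex_inj (star_inj d_even)); apply: eq_bigr => j _.
  rewrite /pair_part ent_proj !YE starK // sgn_star // rmorphM /= rmorphN /= conj_sgn.
  by ring.
have pE' : pair_sum (xi *m xi^t*) = \sum_i \sum_j (Y i j)^* * Y j i.
  rewrite pE exchange_big; apply: eq_bigr => i _; apply: eq_bigr => j _.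
  by rewrite mulrC.
have nY : \sum_i \sum_j Y i j * (Y i j)^* = 1.
  rewrite -nxi norm_vent; apply: eq_bigr => i _.
  rewrite [RHS](reindex_inj (star_inj d_even)); apply: eq_bigr => j _.
  by rewrite YE rmorphM rmorphN /= conj_sgn mulrACA mulrNN sgn2 mul1r.
clearbody Y.
have hZ : \tr ((Y - Y^T)^t* *m (Y - Y^T)) = (1 - pair_sum (xi *m xi^t*)) *+ 2.
  transitivity (\sum_i \sum_j Y i j * (Y i j)^* + \sum_i \sum_j Y j i * (Y j i)^*
     - \sum_i \sum_j Y i j * (Y j i)^* - \sum_i \sum_j (Y i j)^* * Y j i).
    rewrite -big_split -!sumrB; apply: eq_bigr => i _.
    rewrite mxE -big_split -!sumrB; apply: eq_bigr => j _.
    by rewrite !mxE rmorphB /=; ring.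
  by rewrite -pE -pE' nY exchange_big nY mulr2n; ring.
have wle : pair_sum (xi *m xi^t*) <= 1.
  rewrite -subr_ge0 -(pmulrn_lge0 _ (isT : (0 < 2)%N)) -hZ.
  exact: frobenius_ge0.
split=> //.
have [r0|rpos] := posnP r.
  move: nxi; rewrite norm_vent big1 => [/eqP|i _]; first by rewrite eq_sym oner_eq0.
  apply: big1 => j _; rewrite hxi vent_sum big1 ?mul0r // => t.
  by move: (ltn_ord t); rewrite {2}r0.
have := antisym_overlap_le d_even hE hY; rewrite hZ trY rmorphN mulrNN -dE.
rewrite expr2 -mulrA -mulrnAr ler_pM2l ?ltr0n // mulrnAr.
by rewrite ler_pMn2r.
Qed.

(** Both bounds are affine in the state. The bound w <= 1 is needed for each pure term, to enlarge
    its rank r to k. *)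
Lemma schmidt_mixture_witness rho k : schmidt_mixture rho k ->
  diag_sum rho <= k%:R * (1 - pair_sum rho) /\ pair_sum rho <= 1.
Proof.
move=> [n [p [xi [h1 h2 h3 h4 ->]]]].
have dE : diag_sum (\sum_t p t *: (xi t *m (xi t)^t*)) =
    \sum_t p t * diag_sum (xi t *m (xi t)^t*).
  by rewrite diag_sumE mulmx_sumr linear_sum; apply: eq_bigr => t _;
    rewrite -scalemxAr linearZ diag_sumE.
have pE : pair_sum (\sum_t p t *: (xi t *m (xi t)^t*)) =
    \sum_t p t * pair_sum (xi t *m (xi t)^t*).
  by rewrite pair_sumE // mulmx_sumr linear_sum; apply: eq_bigr => t _;
    rewrite -scalemxAr linearZ pair_sumE.
have hw t : diag_sum (xi t *m (xi t)^t*) <= k%:R * (1 - pair_sum (xi t *m (xi t)^t*))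
    /\ pair_sum (xi t *m (xi t)^t*) <= 1.
  have [r rk hr] := h4 t; have [hd hp] := schmidt_rank_witness (h3 t) hr.
  split=> //; apply: le_trans hd _; rewrite ler_wpM2r ?ler_nat // subr_ge0 //.
rewrite dE pE; split; last first.
  rewrite -h2; apply: ler_sum => t _.
  by rewrite -[leRHS]mulr1 ler_wpM2l //; case: (hw t).
rewrite -[X in _ * (X - _)]h2 -sumrB mulr_sumr; apply: ler_sum => t _.
have -> (w : C) : k%:R * (p t - p t * w) = p t * (k%:R * (1 - w)) by ring.
by rewrite ler_wpM2l //; case: (hw t).
Qed.

Section KetSum.
Context (k : nat) (g h : 'I_k -> 'I_d) (g_inj : injective g) (h_inj : injective h).

(** A maximally entangled vector of Schmidt rank k when [g] and [h] are injective; for k = 1 a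
    product vector. *)
Definition ket_sum : 'cV[C]_(d * d) := (sqrtC k%:R)^-1 *: \sum_t ket2 C (g t) (h t).

Let v i j : C := \sum_t (i == g t)%:R * (j == h t)%:R.

Lemma vent_ket_sum i j : vent ket_sum i j = (sqrtC k%:R)^-1 * v i j.
Proof.
by rewrite ventZ vent_sum; congr (_ * _); apply: eq_bigr => t _; rewrite vent_ket2.
Qed.

Context (k_gt0 : (0 < k)%N).

Let kn : k%:R != 0 :> C. Proof. by rewrite pnatr_eq0 -lt0n. Qed.
Let sk0 : sqrtC k%:R != 0 :> C. Proof. by rewrite sqrtC_eq0. Qed.
Let skr : (sqrtC k%:R : C)^* = sqrtC k%:R.
Proof. by rewrite conj_Creal // ger0_real // sqrtC_ge0 ler0n. Qed.
Let skk : (sqrtC k%:R)^-1 * (sqrtC k%:R)^-1 = k%:R^-1 :> C.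
Proof. by rewrite -invfM -expr2 sqrtCK. Qed.

Let conj_v i j : (v i j)^* = v i j.
Proof.
by rewrite rmorph_sum; apply: eq_bigr => t _; rewrite rmorphM /= !conjC_nat.
Qed.

Let v_gh t : v (g t) (h t) = 1.
Proof.
rewrite -[RHS](sum_delta t (fun=> 1)); apply: eq_bigr => s _.
rewrite (inj_eq g_inj) (inj_eq h_inj) (eq_sym s).
by case: (t == s); rewrite ?mulr1 ?mulr0.
Qed.

Let sum_v (F : 'I_d -> 'I_d -> C) : \sum_i \sum_j v i j * F i j = \sum_t F (g t) (h t).
Proof.
transitivity (\sum_i \sum_t (i == g t)%:R * F i (h t)).
  apply: eq_bigr => i _; under eq_bigr do rewrite mulr_suml.
  rewrite exchange_big; apply: eq_bigr => t _.
  rewrite -(sum_delta (h t) (fun j => (i == g t)%:R * F i j)); apply: eq_bigr => j _.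
  by ring.
by rewrite exchange_big; apply: eq_bigr => t _; rewrite sum_delta.
Qed.

Lemma ket_sum_norm : (ket_sum^t* *m ket_sum) 0 0 = 1.
Proof.
rewrite norm_vent.
transitivity (k%:R^-1 * \sum_i \sum_j v i j * v i j).
  rewrite mulr_sumr; apply: eq_bigr => i _; rewrite mulr_sumr; apply: eq_bigr => j _.
  by rewrite vent_ket_sum rmorphM /= conj_v fmorphV /= skr mulrACA skk.
rewrite sum_v (eq_bigr (fun=> 1)) => [|t _]; last exact: v_gh.
by rewrite sumr_const card_ord mulVf.
Qed.

Lemma ket_sum_schmidt_rank : is_schmidt_rank ket_sum k.
Proof.
exists (fun=> (sqrtC k%:R)^-1), (fun t => ket C (g t)), (fun t => ket C (h t)).
have on (u : 'I_k -> 'I_d) : injective u -> orthonormal_family (fun t => ket C (u t)).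
  move=> u_inj s t; rewrite mxE -(inj_eq u_inj).
  rewrite -(sum_delta (u s) (fun i => (i == u t)%:R)); apply: eq_bigr => i _.
  by rewrite !mxE !andbT conjC_nat.
split; [|exact: on|exact: on|by rewrite /ket_sum scaler_sumr].
by move=> _; rewrite invr_gt0 sqrtC_gt0 ltr0n.
Qed.

Lemma ket_sum_mixture : schmidt_mixture (ket_sum *m ket_sum^t*) k.
Proof. exact: schmidt_mixture_pure ket_sum_norm ket_sum_schmidt_rank. Qed.

Lemma ket_sum_trace : \tr (ket_sum *m ket_sum^t*) = 1.
Proof. by rewrite mxtrace_mulC /mxtrace big_ord1 ket_sum_norm. Qed.

Lemma ket_sum_diag :
  diag_sum (ket_sum *m ket_sum^t*) = k%:R^-1 * (\sum_t (g t == h t)%:R) ^+ 2.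
Proof.
have e : \sum_i v i i = \sum_t (g t == h t)%:R.
  rewrite -(sum_v (fun i j => (i == j)%:R)); apply: eq_bigr => i _.
  rewrite -(sum_delta i (fun j => v i j)); apply: eq_bigr => j _.
  by rewrite mulrC eq_sym.
rewrite -e expr2 mulr_suml mulr_sumr; apply: eq_bigr => i _.
rewrite !mulr_sumr; apply: eq_bigr => j _.
by rewrite /diag_part ent_proj !vent_ket_sum rmorphM /= conj_v fmorphV /= skr mulrACA skk.
Qed.

Lemma ket_sum_pair : pair_sum (ket_sum *m ket_sum^t*) =
  k%:R^-1 * \sum_t - (sgn C (g t) * sgn C (h t) * v (star (h t)) (star (g t))).
Proof.
rewrite -(sum_v (fun i j => - (sgn C i * sgn C j * v (star j) (star i)))).
rewrite mulr_sumr; apply: eq_bigr => i _; rewrite mulr_sumr; apply: eq_bigr => j _.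
rewrite /pair_part ent_proj !vent_ket_sum rmorphM /= conj_v fmorphV /= skr -skk.
by ring.
Qed.

End KetSum.

(** The point (p, w) lies in the triangle with vertices (0, 0), (0, 1), (k, 0), each attained by a
    [ket_sum]. The corresponding mixture twirls into the span with the same trace, p and w, hence to
    X. *)
Lemma schmidt_mixture_inv3 a b c k :
  let X := inv3 d a b c : 'M[C]_(d * d) in
  (2 < d)%N -> (0 < k <= d./2)%N -> \tr X = 1 -> 0 <= diag_sum X -> 0 <= pair_sum X ->
  diag_sum X <= k%:R * (1 - pair_sum X) -> schmidt_mixture X k.
Proof.
move=> X d2 /andP[k0 km] trX dX pX hX.
have d4 : (3 < d)%N by have := even_halfE d_even; lia.
have d0 : (0 < d)%N by lia.
have d1 : (1 < d)%N by lia.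
pose i0 := Ordinal d0; pose j0 := Ordinal d1.
have kd : (k <= d)%N by have := even_halfE d_even; lia.
have c1 (i : 'I_d) : injective (fun _ : 'I_1 => i) by move=> s t _; rewrite !ord1.
have mono (Y : 'M[C]_(d * d)) : schmidt_mixture Y 1 -> schmidt_mixture Y k.
  exact: schmidt_mixture_mono.
have [Q0 [Q0m Q0t Q0d Q0p]] : exists Y : 'M[C]_(d * d),
    [/\ schmidt_mixture Y k, \tr Y = 1, diag_sum Y = 0 & pair_sum Y = 0].
  exists (ket_sum (fun _ : 'I_1 => i0) (fun _ : 'I_1 => j0) *m
    (ket_sum (fun _ : 'I_1 => i0) (fun _ : 'I_1 => j0))^t*); split.
  - by apply: mono; apply: ket_sum_mixture.
  - by rewrite ket_sum_trace.
  - by rewrite ket_sum_diag // big_ord1 /= expr0n mulr0.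
  rewrite ket_sum_pair // !big_ord1.
  have -> : (star j0 == i0) = false.
    apply/eqP => /(congr1 (@nat_of_ord d)); rewrite star_val //=.
    by have := even_halfE d_even; case: ifP => /=; lia.
  by rewrite /= mul0r mulr0 oppr0 mulr0.
have [Q1 [Q1m Q1t Q1d Q1p]] : exists Y : 'M[C]_(d * d),
    [/\ schmidt_mixture Y k, \tr Y = 1, diag_sum Y = 0 & pair_sum Y = 1].
  exists (ket_sum (fun _ : 'I_1 => i0) (fun _ : 'I_1 => star i0) *m
    (ket_sum (fun _ : 'I_1 => i0) (fun _ : 'I_1 => star i0))^t*); split.
  - by apply: mono; apply: ket_sum_mixture.
  - by rewrite ket_sum_trace.
  - by rewrite ket_sum_diag // big_ord1 neq_star // expr0n mulr0.
  rewrite ket_sum_pair // !big_ord1 starK // !eqxx sgn_star // mulrN sgn2.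
  by rewrite /= invr1; ring.
have [Qk [Qkm Qkt Qkd Qkp]] : exists Y : 'M[C]_(d * d),
    [/\ schmidt_mixture Y k, \tr Y = 1, diag_sum Y = k%:R & pair_sum Y = 0].
  have g_inj : injective (widen_ord kd).
    by move=> s t /(congr1 (@nat_of_ord d)) /= st; apply: ord_inj.
  exists (ket_sum (widen_ord kd) (widen_ord kd) *m (ket_sum (widen_ord kd) (widen_ord kd))^t*).
  split.
  - exact: ket_sum_mixture.
  - by rewrite ket_sum_trace.
  - rewrite ket_sum_diag // (eq_bigr (fun=> 1)) => [|t _]; last by rewrite eqxx.
    by rewrite sumr_const card_ord expr2 mulKf // pnatr_eq0 -lt0n.
  rewrite ket_sum_pair // big1 ?mulr0 // => t _.
  rewrite big1 ?mulr0 ?oppr0 // => s _.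
  (* As k <= d/2, no two of the first k indices are partners, so w vanishes. *)
  have -> : (star (widen_ord kd t) == widen_ord kd s) = false.
    apply/eqP => /(congr1 (@nat_of_ord d)); rewrite star_val //=.
    have := ltn_ord t; have := ltn_ord s; have := even_halfE d_even; case: ifP => /=; lia.
  by rewrite mul0r.
set D := diag_sum X in dX hX; set P := pair_sum X in pX hX.
have kn : k%:R != 0 :> C by rewrite pnatr_eq0 -lt0n.
have kpos : 0 < k%:R :> C by rewrite ltr0n.
have wk0 : 0 <= D / k%:R by rewrite mulr_ge0 // invr_ge0 ler0n.
have wk1 : D / k%:R <= 1 - P by rewrite ler_pdivrMr // mulrC.
have P1 : P <= 1 by rewrite -subr_ge0; apply: le_trans wk1.
(* For P = 1 the quotient is 0 by convention, which fits because D is then 0. *)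
pose t := D / k%:R / (1 - P).
have tP : t * (1 - P) = D / k%:R.
  have [P1e|P1n] := eqVneq P 1; last by rewrite /t divfK // subr_eq0 eq_sym.
  move: wk1; rewrite P1e subrr mulr0 => wk1.
  by apply/eqP; rewrite eq_le wk0 wk1.
have t0 : 0 <= t by rewrite /t mulr_ge0 // invr_ge0 subr_ge0.
have t1 : t <= 1.
  have [P1e|P1n] := eqVneq P 1; first by rewrite /t P1e subrr invr0 mulr0 ler01.
  by rewrite /t ler_pdivrMr ?mul1r // subr_gt0 lt_neqAle P1n.
(* Barycentric coordinates of (D, P) with respect to the three vertices. *)
pose Z := P *: Q1 + (1 - P) *: (t *: Qk + (1 - t) *: Q0).
have hZ : schmidt_mixture Z k by do 2 (apply: schmidt_mixture_conv => //).
have diag_lin a1 a2 (Y1 Y2 : 'M[C]_(d * d)) :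
    diag_sum (a1 *: Y1 + a2 *: Y2) = a1 * diag_sum Y1 + a2 * diag_sum Y2.
  by rewrite !diag_sumE mulmxDr -!scalemxAr linearD !linearZ.
have pair_lin a1 a2 (Y1 Y2 : 'M[C]_(d * d)) :
    pair_sum (a1 *: Y1 + a2 *: Y2) = a1 * pair_sum Y1 + a2 * pair_sum Y2.
  by rewrite !pair_sumE // mulmxDr -!scalemxAr linearD !linearZ.
have [a' [b' [c' hr]]] := reach_inv3 d_even Z d2.
rewrite (_ : X = inv3 d a' b' c'); first exact: schmidt_mixture_reach hr hZ.
apply: inv3_eq => //; rewrite -/X.
- rewrite (reach_mxtrace hr) trX /Z !(linearD, linearZ) /= Q1t Qkt Q0t.
  by ring.
- rewrite (reach_diag_sum hr) -/D /Z !diag_lin Q1d Qkd Q0d !mulr0 addr0 add0r.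
  by rewrite mulrA (mulrC _ t) tP divfK.
by rewrite (reach_pair_sum d_even hr) -/P /Z !pair_lin Q1p Qkp Q0p; ring.
Qed.

End Region.

(** * The PPT condition *)

Section PPT.
Context (C : numClosedFieldType) (d : nat) (d_even : ~~ odd d).
Implicit Types (X : 'M[C]_(d * d)) (xi : 'cV[C]_(d * d)).

Lemma psd_conj n (U A : 'M[C]_n) : psd A -> psd (U *m A *m U^t*).
Proof.
move=> [hA pA]; split; first by rewrite !adjmxM adjmxK hA mulmxA.
move=> v; have := pA (U^t* *m v).
by rewrite adjmxM adjmxK !mulmxA.
Qed.

Lemma schmidt_mixture_psd X k : schmidt_mixture X k -> psd X.
Proof.
move=> [n [p [xi [h1 _ _ _ ->]]]].
have hp t : (p t)^* = p t by rewrite conj_Creal // ger0_real.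
split=> [|v].
  rewrite raddf_sum map_mx_sum; apply: eq_bigr => t _.
  by rewrite adjmxZ adjmxM adjmxK hp.
rewrite mulmx_sumr mulmx_suml summxE; apply: sumr_ge0 => t _.
rewrite -scalemxAr -scalemxAl mxE mulr_ge0 //.
have -> : v^t* *m (xi t *m (xi t)^t*) *m v = (v^t* *m xi t) *m (v^t* *m xi t)^t*.
  by rewrite adjmxM adjmxK !mulmxA.
by rewrite mxE big_ord1 !mxE mul_conjC_ge0.
Qed.

Lemma quad_ket2 X i j k l :
  ((ket2 C i j)^t* *m X *m ket2 C k l) 0 0 = ent X i j k l.
Proof.
rewrite mxE sum_mxtens.
rewrite -(sum_delta k (fun k' => ent X i j k' l)); apply: eq_bigr => k' _.
rewrite -(sum_delta l (fun l' => ent X i j k' l')) mulr_sumr; apply: eq_bigr => l' _.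
rewrite -/(vent _ _ _) vent_ket2 mulrC mulrA; congr (_ * _).
rewrite mxE sum_mxtens.
rewrite -(sum_delta i (fun i' => ent X i' j k' l')); apply: eq_bigr => i' _.
rewrite -(sum_delta j (fun j' => ent X i' j' k' l')) mulr_sumr; apply: eq_bigr => j' _.
by rewrite [(_ ^t*) _ _]mxE [(_^T) _ _]mxE -/(vent _ _ _) vent_ket2 rmorphM /= !conjC_nat mulrA.
Qed.

Lemma psd_antisym_test X i j k l : psd X ->
  0 <= ent X i j i j - ent X i j k l - ent X k l i j + ent X k l k l.
Proof.
move=> [_ /(_ (ket2 C i j - ket2 C k l))].
rewrite adjmxB mulmxBl !mulmxBr !mulmxBl.
have mxB00 (A B : 'M[C]_1) : (A - B) 0 0 = A 0 0 - B 0 0 by rewrite !mxE.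
rewrite !mxB00 !quad_ket2; congr (0 <= _); ring.
Qed.

Lemma ent_partial_transpose X i j k l :
  ent (partial_transpose X) i j k l = ent X i l k j.
Proof. by rewrite /ent mxE !mxtens_indexK. Qed.

(** Partial transposition exchanges the flip with the projector on [maxent]; up to the local Omega
    this exchanges the coefficients b and c. *)
Lemma partial_transpose_inv3 a b c :
  partial_transpose (inv3 d a b c : 'M[C]_(d * d)) =
  (1%:M *t Omega C d) *m inv3 d a c b *m (1%:M *t Omega C d)^t*.
Proof.
apply: ent_inj => i j k l.
rewrite ent_partial_transpose ent_local_Omega // !ent_inv3 // starK // !star_eq //.
rewrite (eq_sym l j) (eq_sym l i) -(star_eqC d_even i j) (eq_sym (star i)) sgn_star //.
have h1 : sgn C j * sgn C l * (j == l)%:R = (j == l)%:R.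
  by case: eqP => [->|_]; rewrite ?mulr0 // sgn2 mul1r.
have h2 : sgn C j * (j == star i)%:R = - sgn C i * (j == star i)%:R.
  by case: eqP => [->|_]; rewrite ?mulr0 // sgn_star.
have h3 : sgn C l * sgn C i * (i == l)%:R = (i == l)%:R.
  by case: eqP => [->|_]; rewrite ?mulr0 // sgn2 mul1r.
transitivity (a * (i == k)%:R * (sgn C j * sgn C l * (j == l)%:R)
   + c * (k == star l)%:R * sgn C l * (sgn C j * (j == star i)%:R)
   + b * (sgn C j * sgn C j) * (k == j)%:R * (sgn C l * sgn C i * (i == l)%:R)).
  by rewrite h1 h2 h3 sgn2; ring.
by ring.
Qed.

Lemma mxtrace_quad (v : 'cV[C]_(d * d)) X :
  (v^t* *m X *m v) 0 0 = \tr ((v *m v^t*) *m X).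
Proof.
by rewrite -[in RHS]mulmxA [RHS]mxtrace_mulC /mxtrace big_ord1.
Qed.

Lemma psd_diag_sum X : psd X -> 0 <= diag_sum X.
Proof. by case=> _ h; rewrite diag_sumE -mxtrace_quad. Qed.

Lemma psd_partial_transpose_inv3 a b c :
  psd (partial_transpose (inv3 d a b c : 'M[C]_(d * d))) <-> psd (inv3 d a c b : 'M[C]_(d * d)).
Proof.
rewrite partial_transpose_inv3; set U := 1%:M *t Omega C d; split; last exact: psd_conj.
have UU : U^t* *m U = 1%:M.
  rewrite adjmx_tens Omega_adj // trmx1 map_mx1 tensmx_mul mulmx1 mulNmx Omega2 // opprK.
  exact: tensmx1.
move=> /(psd_conj (U^t*)); rewrite adjmxK.
by rewrite !mulmxA UU mul1mx -mulmxA UU mulmx1.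
Qed.

(** Two test vectors suffice: [maxent], and |i j*> - |j i*> for a generic pair i, j in the lower
    half, which is orthogonal to [maxent] and negated by W. *)
Lemma psd_inv3 a b c : (2 < d)%N -> psd (inv3 d a b c : 'M[C]_(d * d)) ->
  0 <= a + d%:R * b - c /\ 0 <= a - c.
Proof.
move=> d2 pX; have hd := even_halfE d_even.
have d0 : (0 < d)%N by lia.
have d1 : (1 < d)%N by lia.
split.
  have := psd_diag_sum pX; rewrite diag_sum_inv3 //.
  by rewrite pmulr_rge0 // ltr0n.
pose i := Ordinal d0; pose j := Ordinal d1.
have lj : (j < d./2)%N by rewrite /=; lia.
have li : (i < d./2)%N by rewrite /=; lia.
have ij : (i == j) = false by [].
have ji : (j == i) = false by [].
have isj : (i == star j) = false.
  by apply/eqP => /(congr1 (@nat_of_ord d)); rewrite star_val // lj /=; lia.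
have jsi : (j == star i) = false by rewrite -star_eqC // eq_sym isj.
have si : sgn C i = 1 by rewrite /sgn li.
have sj : sgn C j = 1 by rewrite /sgn lj.
have := psd_antisym_test i (star j) j (star i) pX.
rewrite !ent_inv3 // !starK // !star_eq // ij ji isj jsi !eqxx ?star_eqC // ?isj ?jsi ?ij ?ji.
rewrite !sgn_star // si sj ?(eq_sym (star _)) ?ij ?ji ?isj ?jsi /= => h.
have : 0 <= (a - c) *+ 2 by move: h; congr (0 <= _); ring.
by rewrite pmulrn_lge0.
Qed.

Lemma PPT_inv3 a b c :
  let X := inv3 d a b c : 'M[C]_(d * d) in
  (2 < d)%N -> is_PPT_state X ->
  [/\ 0 <= diag_sum X, 0 <= pair_sum X, 0 <= a - c & 0 <= a - b].
Proof.
move=> X d2 [[pX _] /psd_partial_transpose_inv3 pT].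
have [h1 h2] := psd_inv3 d2 pX; have [h3 h4] := psd_inv3 d2 pT.
rewrite diag_sum_inv3 // pair_sum_inv3 // !mulr_ge0 ?ler0n //.
by move: h3; congr (0 <= _); ring.
Qed.

(** PPT puts (p, w) into the triangle for k = d/2: with trace one, the slack of its long side is d
    (d^2 - d - 2)(a - c)/2. *)
Lemma PPT_inv3_mixture a b c :
  let X := inv3 d a b c : 'M[C]_(d * d) in
  (2 < d)%N -> is_PPT_state X -> schmidt_mixture X d./2.
Proof.
move=> X d2 hX; have [h1 h2 h3 _] := PPT_inv3 d2 hX.
have [[_ trX] _] := hX; have hd := even_halfE d_even.
apply: schmidt_mixture_inv3 => //; first by rewrite leqnn andbT; lia.
rewrite -subr_ge0 -(pmulrn_lge0 _ (isT : (0 < 2)%N)).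
have -> : (d./2%:R * (1 - pair_sum X) - diag_sum X) *+ 2 =
    d%:R * ((1 - pair_sum X) - (a + d%:R * b - c) *+ 2).
  have dE : d%:R = d./2%:R *+ 2 :> C by rewrite -mulrnA muln2 -addnn -hd.
  transitivity ((d./2%:R *+ 2) * (1 - pair_sum X) - diag_sum X *+ 2); first by ring.
  by rewrite -dE diag_sum_inv3 //; ring.
rewrite mulr_ge0 ?ler0n //.
have -> : 1 - pair_sum X = \tr X - pair_sum X by rewrite trX.
rewrite mxtrace_inv3 // pair_sum_inv3 //.
have -> : d%:R * (d%:R * a + b + c) - d%:R * (a - b + d%:R * c) - (a + d%:R * b - c) *+ 2
   = (d%:R ^+ 2 - d%:R - 2%:R) * (a - c) by ring.
rewrite mulr_ge0 // -addrA -opprD subr_ge0 expr2 -natrM -natrD ler_nat.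
by nia.
Qed.
End PPT.

Local Open Scope complex_scope.

(** As soon as some decomposition exists, well-ordering provides the least rank bound, so the
    Schmidt number is attained. *)
Lemma schmidt_number_leP (C : numClosedFieldType) (d : nat) (rho : 'M[C]_(d * d)) k :
  schmidt_number_le rho k <-> schmidt_mixture rho k.
Proof.
split=> [[m mk [hm _]]|hk]; first exact: schmidt_mixture_mono hm.
have ex : exists j, `[< schmidt_mixture rho j >] by exists k; apply/asboolP.
case: (ex_minnP ex) => m /asboolP hm min_m.
exists m; first by apply: min_m; apply/asboolP.
by split=> // j hj; apply: min_m; apply/asboolP.
Qed.

Lemma omega_proj (C : numClosedFieldType) (d : nat) :
  omega C d *m (omega C d)^t* = d%:R^-1 *: (maxent C d *m (maxent C d)^t*).
Proof.
have -> : omega C d = (sqrtC d%:R)^-1 *: maxent C d by [].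
rewrite adjmxZ -scalemxAl -scalemxAr scalerA; congr (_ *: _).
rewrite fmorphV /= conj_Creal ?ger0_real ?sqrtC_ge0 ?ler0n //.
by rewrite -invfM -expr2 sqrtCK.
Qed.

(** * The two-parameter family of states *)

Section Werner.
Context (R : realType) (d : nat) (d_even : ~~ odd d) (d4 : (4 <= d)%N).
Implicit Types (a b : R).

Let d2 : (2 < d)%N. Proof. exact: leq_trans d4. Qed.
Let dn : d%:R != 0 :> R. Proof. by rewrite pnatr_eq0; lia. Qed.
Let dn4 : 4%:R <= d%:R :> R. Proof. by rewrite ler_nat. Qed.
Let half_d : d./2%:R = d%:R / 2%:R :> R.
Proof.
have -> : d%:R = d./2%:R * 2%:R :> R.
  by rewrite -natrM muln2 -addnn -(even_halfE d_even).
by rewrite mulfK // pnatr_eq0.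
Qed.

Lemma rho_abE a b : rho_ab d a b =
  inv3 d ((1 - a - b) / d%:R ^+ 2)%:C (a / d%:R)%:C (b / d%:R)%:C.
Proof.
rewrite /rho_ab omega_proj tensmx1 scalerA (_ : a%:C / d%:R = (a / d%:R)%:C) //.
by rewrite rmorphM fmorphV rmorph_nat.
Qed.

(** The value of p on [rho_ab]; since exchanging a and b exchanges p and w, [diag_ab b a] is the
    value of w. *)
Definition diag_ab a b : R := (1 + (d%:R ^+ 2 - 1) * a - (d%:R + 1) * b) / d%:R.

Lemma rho_ab_diag a b : diag_sum (rho_ab d a b) = (diag_ab a b)%:C.
Proof.
rewrite rho_abE diag_sum_inv3 // -(rmorph_nat (real_complex R)) -!(rmorphM, rmorphD, rmorphB).
by congr (_%:C); rewrite /diag_ab; field.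
Qed.

Lemma rho_ab_pair a b : pair_sum (rho_ab d a b) = (diag_ab b a)%:C.
Proof.
rewrite rho_abE pair_sum_inv3 // -(rmorph_nat (real_complex R)) -!(rmorphM, rmorphD, rmorphB).
by congr (_%:C); rewrite /diag_ab; field.
Qed.

Lemma rho_ab_trace a b : \tr (rho_ab d a b) = 1.
Proof.
rewrite rho_abE mxtrace_inv3 // -(rmorph_nat (real_complex R)) -!(rmorphM, rmorphD).
by rewrite -[RHS](rmorph1 (real_complex R)); congr (_%:C); field.
Qed.

Lemma rho_ab_witness a b k : schmidt_mixture (rho_ab d a b) k ->
  diag_ab a b <= k%:R * (1 - diag_ab b a) /\ diag_ab b a <= 1.
Proof.
move=> /(schmidt_mixture_witness d_even); rewrite rho_ab_diag rho_ab_pair.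
rewrite -(rmorph_nat (real_complex R)) -(rmorph1 (real_complex R)).
by rewrite -rmorphB -rmorphM !lecR.
Qed.

Lemma rho_ab_mixture a b k : (0 < k <= d./2)%N -> 0 <= diag_ab a b -> 0 <= diag_ab b a ->
  diag_ab a b <= k%:R * (1 - diag_ab b a) -> schmidt_mixture (rho_ab d a b) k.
Proof.
move=> hk h1 h2 h3; have := rho_ab_diag a b; have := rho_ab_pair a b.
have := rho_ab_trace a b; rewrite rho_abE => ht hp hd.
apply: schmidt_mixture_inv3 => //; rewrite ?hp ?hd ?lecR ?ler0c //.
rewrite -(rmorph_nat (real_complex R)) -(rmorph1 (real_complex R)).
by rewrite -rmorphB -rmorphM lecR.
Qed.

Let half_wit a b : a + (1 + d%:R) * b <= 1 -> diag_ab a b <= d./2%:R * (1 - diag_ab b a).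
Proof.
move=> h; rewrite -subr_ge0 half_d.
have -> : d%:R / 2%:R * (1 - diag_ab b a) - diag_ab a b =
   (d%:R + 1) * (d%:R - 2%:R) / (2%:R * d%:R) * (1 - (a + (1 + d%:R) * b)).
  by rewrite /diag_ab; field.
have h4 := dn4; rewrite mulr_ge0 ?subr_ge0 // divr_ge0 ?mulr_ge0; lra.
Qed.

(** Positivity needs no spectrum: the hypotheses place the point in the triangle for k = d/2, and
    mixtures of pure states are positive. *)
Lemma rho_ab_psd a b : 0 <= diag_ab a b -> 0 <= diag_ab b a ->
  a + (1 + d%:R) * b <= 1 -> psd (rho_ab d a b).
Proof.
move=> h1 h2 h3; apply: (@schmidt_mixture_psd _ _ _ d./2).
apply: rho_ab_mixture => //; first by rewrite leqnn andbT; lia.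
exact: half_wit.
Qed.

(** The conditions are symmetric in a and b, as is the PPT property, so positivity of the partial
    transpose follows from positivity with a and b exchanged. *)
Lemma rho_ab_PPT a b : is_PPT_state (rho_ab d a b) <->
  [/\ 0 <= diag_ab a b, 0 <= diag_ab b a, a + (1 + d%:R) * b <= 1 & (1 + d%:R) * a + b <= 1].
Proof.
split=> [hP|[h1 h2 h3 h4]].
  have hd := rho_ab_diag a b; have hp := rho_ab_pair a b.
  move: hP hd hp; rewrite rho_abE => hP hd hp.
  have [] := PPT_inv3 d_even d2 hP; rewrite hd hp.
  rewrite -!rmorphB -(rmorph0 (real_complex R)) !lecR => h1 h2 h3 h4; split=> //.
    rewrite -subr_ge0; have -> : 1 - (a + (1 + d%:R) * b) =
      d%:R ^+ 2 * ((1 - a - b) / d%:R ^+ 2 - b / d%:R) by field.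
    by rewrite mulr_ge0 // exprn_ge0.
  rewrite -subr_ge0; have -> : 1 - ((1 + d%:R) * a + b) =
    d%:R ^+ 2 * ((1 - a - b) / d%:R ^+ 2 - a / d%:R) by field.
  by rewrite mulr_ge0 // exprn_ge0.
have h4' : b + (1 + d%:R) * a <= 1 by rewrite addrC.
split; first by split; [exact: rho_ab_psd | exact: rho_ab_trace].
rewrite rho_abE; apply/psd_partial_transpose_inv3 => //.
have := rho_ab_psd h2 h1 h4'; rewrite rho_abE.
by rewrite addrAC.
Qed.

(** Eliminating b gives a >= 0, and eliminating a gives (d^2 - 2d - 4) b >= d - 4, hence b >= 0. The
    numerators of p and w are the slacks of the two upper bounds plus d^2 a and d^2 b. *)
Lemma region_diag a b : 1 / (d%:R - 3%:R) * a + b > 1 / (d%:R + 1) ->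
  a + (1 + d%:R) * b <= 1 -> (1 + d%:R) * a + b <= 1 ->
  0 <= diag_ab a b /\ 0 <= diag_ab b a.
Proof.
move=> h1 h2 h3; have h4 := dn4.
have d3 : 0 < d%:R - 3%:R :> R by lra.
have d1 : 0 < d%:R + 1 :> R by lra.
have {}h1 : d%:R - 3%:R < (d%:R + 1) * a + (d%:R - 3%:R) * (d%:R + 1) * b.
  rewrite -subr_gt0; have -> : (d%:R + 1) * a + (d%:R - 3) * (d%:R + 1) * b - (d%:R - 3) =
     (d%:R - 3%:R) * (d%:R + 1) * (1 / (d%:R - 3) * a + b - 1 / (d%:R + 1)) :> R.
    by field; rewrite !gt_eqF.
  by rewrite mulr_gt0 ?subr_gt0 // mulr_gt0.
have a0 : 0 <= a.
  have : (d%:R - 3%:R) * (a + (1 + d%:R) * b) <= (d%:R - 3%:R) * 1 by rewrite ler_wpM2l // ltW.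
  by move=> h5; lra.
have b0 : 0 <= b.
  suff : 0 <= (d%:R ^+ 2 - 2%:R * d%:R - 4%:R) * b.
    by rewrite pmulr_rge0 // expr2; nra.
  by lra.
rewrite /diag_ab !divr_ge0 ?ler0n //.
  have : 0 <= d%:R ^+ 2 * b by rewrite mulr_ge0 // exprn_ge0.
  lra.
have : 0 <= d%:R ^+ 2 * a by rewrite mulr_ge0 // exprn_ge0.
lra.
Qed.

(** The two slacks differ by the factor (d + 1)(d - 3)/2, which is positive. *)
Lemma region_line a b : (1 / (d%:R + 1) < 1 / (d%:R - 3%:R) * a + b) =
  ((d./2 - 1)%:R * (1 - diag_ab b a) < diag_ab a b).
Proof.
have h4 := dn4; have d3 : 0 < d%:R - 3%:R :> R by lra.
have d1 : 0 < d%:R + 1 :> R by lra.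
rewrite natrB ?half_d; last by lia.
rewrite -subr_gt0 -[RHS]subr_gt0.
have -> : diag_ab a b - (d%:R / 2%:R - 1) * (1 - diag_ab b a) =
  ((d%:R + 1) * (d%:R - 3%:R) / 2%:R) * (1 / (d%:R - 3%:R) * a + b - 1 / (d%:R + 1)).
  by rewrite /diag_ab; field; rewrite dn !gt_eqF.
by rewrite pmulr_rgt0 // divr_gt0 ?mulr_gt0 ?ltr0n.
Qed.

End Werner.

(** * The regions in the (a, b)-plane *)

Local Open Scope classical_set_scope.

Theorem corollary4p3 (R : realType) (d : nat) (hd : (4 <= d)%N)
    (d_even : ~~ odd d) :
  (forall k : nat, (1 <= k <= d./2 - 1)%N ->
     PPT_region R d `\` SN_region R d k !=set0) /\
  PPT_region R d `<=` SN_region R d d./2 /\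
  PPT_region R d `\` SN_region R d (d./2 - 1) =
    [set ab : R * R |
       [/\ 1 / (d%:R - 3) * ab.1 + ab.2 > 1 / (d%:R + 1),
           ab.1 + (1 + d%:R) * ab.2 <= 1
         & (1 + d%:R) * ab.1 + ab.2 <= 1]] /\
  [set ab : R * R |
       [/\ 1 / (d%:R - 3) * ab.1 + ab.2 > 1 / (d%:R + 1),
           ab.1 + (1 + d%:R) * ab.2 <= 1
         & (1 + d%:R) * ab.1 + ab.2 <= 1]] =
    [set ab : R * R | is_PPT_state (rho_ab d ab.1 ab.2) /\
                      is_schmidt_number (rho_ab d ab.1 ab.2) d./2] /\
  (forall rho : 'M[R[i]]_(d * d),
     is_PPT_state rho -> SSbar_invariant rho -> schmidt_number_le rho d./2).
Proof.
have d2 : (2 < d)%N by exact: leq_trans hd.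
have hhalf : (1 < d./2)%N by have := even_halfE d_even; lia.
have PPT_mix a b : is_PPT_state (rho_ab d a b) ->
    schmidt_mixture (rho_ab d a b : 'M[R[i]]_(d * d)) d./2.
  by rewrite rho_abE; exact: PPT_inv3_mixture.
have diffE (a b : R) : (PPT_region R d `\` SN_region R d (d./2 - 1)) (a, b) <->
    is_PPT_state (rho_ab d a b) /\ ~ schmidt_mixture (rho_ab d a b) (d./2 - 1).
  rewrite /PPT_region /SN_region /classical_sets.setD /=; split=> -[hP hn]; split=> //.
    by move=> hm; apply: hn; split; [case: hP | apply/schmidt_number_leP].
  by move=> [_ /schmidt_number_leP].
(* For k = d/2 - 1 the inequality p <= k (1 - w) is both necessary and sufficient within the PPT
   region, and the line of the statement is its negation. *)
have regionE (a b : R) :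
    [/\ 1 / (d%:R - 3) * a + b > 1 / (d%:R + 1), a + (1 + d%:R) * b <= 1
      & (1 + d%:R) * a + b <= 1] <->
    is_PPT_state (rho_ab d a b) /\ ~ schmidt_mixture (rho_ab d a b) (d./2 - 1).
  split=> [[h1 h2 h3]|[/rho_ab_PPT [] // p1 p2 p3 p4 hn]].
    split; first by apply/rho_ab_PPT => //; have [] := region_diag hd h1 h2 h3.
    by move=> /rho_ab_witness []// + _; rewrite region_line // ltNge in h1 => /idP;
      rewrite (negPf h1).
  split=> //; rewrite region_line // ltNge; apply/negP => h; apply: hn.
  by apply: rho_ab_mixture => //; lia.
have S_mono j k : (j <= k)%N -> SN_region R d j `<=` SN_region R d k.
  move=> jk ab [h1 /schmidt_number_leP h2]; split=> //; apply/schmidt_number_leP.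
  exact: schmidt_mixture_mono h2.
split; [|split; [|split; [|split]]].
(* One point serves all k, as the sets grow with k: the vertex at which the two upper bounds hold
   with equality. *)
- move=> k /andP[k0 km]; exists ((d%:R + 2)^-1, (d%:R + 2)^-1).
  have : (PPT_region R d `\` SN_region R d (d./2 - 1)) ((d%:R + 2)^-1, (d%:R + 2)^-1).
    apply/diffE/regionE; have h4 : 4%:R <= d%:R :> R by rewrite ler_nat.
    have hx : d%:R + 2 != 0 :> R by rewrite gt_eqF //; lra.
    have hy : d%:R - 3 != 0 :> R by rewrite gt_eqF //; lra.
    have hz : d%:R + 1 != 0 :> R by rewrite gt_eqF //; lra.
    split.
    - rewrite -subr_gt0.
      have -> : 1 / (d%:R - 3) * (d%:R + 2)^-1 + (d%:R + 2)^-1 - 1 / (d%:R + 1) =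
        4%:R / ((d%:R - 3) * (d%:R + 2) * (d%:R + 1)) :> R by field; rewrite hx hy hz.
      by rewrite divr_gt0 // !mulr_gt0 //; lra.
    - by rewrite le_eqVlt; apply/orP; left; apply/eqP; field.
    by rewrite le_eqVlt; apply/orP; left; apply/eqP; field.
  by move=> [h1 h2]; split=> // /(S_mono _ _ km).
- move=> [a b] hP; split; first by case: hP.
  by apply/schmidt_number_leP; exact: PPT_mix.
- by apply/seteqP; split=> -[a b] h;  [apply/regionE/diffE|apply/diffE/regionE].
- apply/seteqP; split=> -[a b] /=.
    move=> /regionE[hP hn]; split=> //; split; first exact: PPT_mix.
    (* A decomposition with j < d/2 would be one of ranks at most d/2 - 1. *)
    move=> j hj; rewrite leqNgt; apply/negP => jm; apply: hn.
    by apply: schmidt_mixture_mono hj; lia.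
  move=> [hP [_ hmin]]; apply/regionE; split=> // /hmin; lia.
move=> rho hP hinv; apply/schmidt_number_leP.
(* The hull of an invariant state meets the span, so the state itself lies there. *)
have [a [b [c hr]]] := reach_inv3 d_even rho d2.
have e := reach_invariant hinv hr; rewrite -e in hP *.
exact: PPT_inv3_mixture.
Qed.
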